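(* Let $p\colon\mathbb{E}\to\mathbb{B}$ be a locally small, internally closed cartesian monoidal fibration with fibred pushouts and fibred pullbacks, where $\mathbb{B}$ has finite limits (in particular a terminal object $1$). Let $m_0$ be a vertical map of $\mathbb{E}$ in the fibre over $1$. Let $m$ be vertical over $I$ and $f$ vertical over $J$. Then solutions of the universal lifting problem from $I^*(m_0)\mathbin{\hat\otimes}_I m$ to $f$ correspond precisely to solutions of the universal lifting problem from $m$ to $\widehat{\{m_0,f\}}$.
   Context: Fibrations. $p$ is cloven with reindexing $\sigma^*$. Vertical maps are those sent by $p$ to identities, $\mathbb{E}_I$ is the fibre, $V(\mathbb{E})$ the full subcategory of $\mathbb{E}^{\mathbf 2}$ on vertical maps, fibred over $\mathbb{B}$ with levelwise reindexing. $p$ is locally small if for all $X,Y\in\mathbb{E}_I$ the functor $(u\colon J\to I)\mapsto\mathbb{E}_J(u^*X,u^*Y)$ on $(\mathbb{B}/I)^{op}$ is representable. Fibred pushouts (pullbacks): each fibre has them and reindexing preserves them. Monoidal fibrations. A cartesian monoidal fibration is a fibration $p$ with a monoidal structure $\otimes$ on $\mathbb{E}$ and the cartesian product monoidal structure on $\mathbb{B}$ such that $p$ is strictly monoidal and $\otimes$ preserves cartesian maps. Each fibre then has a monoidal product $X\otimes_IY=\Delta_I^*(X\otimes Y)$, with $\Delta_I\colon I\to I\times I$ the diagonal, and reindexing preserves these up to natural isomorphism. It is internally closed if for all $X\in\mathbb{E}_I$ the functors $-\otimes_IX$ and $X\otimes_I-$ have right adjoints and reindexing preserves these right adjoints. Write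 $\{X,-\}_I$ for the right adjoint of $X\otimes_I-$. $I^*$ denotes reindexing along $I\to1$. Pushout product: for $g\colon A\to B$ and $g'\colon A'\to B'$ in $\mathbb{E}_I$, $g\mathbin{\hat\otimes}_Ig'$ is the induced map $(A\otimes_IB')\amalg_{A\otimes_IA'}(B\otimes_IA')\to B\otimes_IB'$. Pullback cotensor: with $m_{0,J}:=J^*(m_0)\colon A\to B$ and $f\colon X\to Y$ in $\mathbb{E}_J$, $\widehat{\{m_0,f\}}$ denotes the vertical map over $J$ $$\{B,X\}_J\to\{A,X\}_J\times_{\{A,Y\}_J}\{B,Y\}_J .$$ Universal lifting problem. For $n\colon U\to V$ vertical over $I$ and $g\colon X\to Y$ vertical over $J$, a family of lifting problems from $n$ to $g$ over $K$ is $\sigma\colon K\to I$, $\tau\colon K\to J$ and a morphism $h\colon\sigma^*(n)\to g$ in $V(\mathbb{E})$ over $\tau$; a solution is $j\colon\sigma^*(V)\to X$ over $\tau$ making both triangles commute. The universal one, $(\underline{\mathrm{Hom}}(n,g),\sigma,\tau,h)$, is such that every family $(K',\sigma',\tau',h')$ is $(\sigma t,\tau t,h\circ c)$ for a unique $t\colon K'\to\underline{\mathrm{Hom}}(n,g)$, with $c\colon\sigma'^*(n)\to\sigma^*(n)$ the canonical cartesian map over $t$. *)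

(* Defs.v *)
(* Based on Stdlib.  Hom-sets are types and morphisms are compared by Leibniz
   equality. *)
From Stdlib Require Import FinFun ProofIrrelevance IndefiniteDescription.

Set Implicit Arguments.
Unset Strict Implicit.
Unset Printing Implicit Defensive.
Set Maximal Implicit Insertion.

Definition the {A : Type} {P : A -> Prop} (H : exists! x, P x) : A :=
  proj1_sig (constructive_definite_description P H).

Lemma the_spec {A : Type} {P : A -> Prop} (H : exists! x, P x) : P (the H).
Proof. exact (proj2_sig (constructive_definite_description P H)). Qed.

Lemma the_unique {A : Type} {P : A -> Prop} (H : exists! x, P x) (x : A) :
  P x -> the H = x.
Proof.
  intros Hx. destruct H as [y [Hy Hu]] eqn:E. rewrite <- (Hu x Hx).
  symmetry. apply Hu. rewrite <- E. apply the_spec.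
Qed.

(** * Categories *)

Record Category := {
  ob :> Type;
  hom : ob -> ob -> Type;
  idm : forall x, hom x x;
  comp : forall x y z, hom y z -> hom x y -> hom x z;
  comp_id_l : forall x y (f : hom x y), comp (idm y) f = f;
  comp_id_r : forall x y (f : hom x y), comp f (idm x) = f;
  comp_assoc : forall x y z w (h : hom z w) (g : hom y z) (f : hom x y),
    comp h (comp g f) = comp (comp h g) f
}.
Arguments hom {_} _ _.
Arguments idm {_} _.
Arguments comp {_ _ _ _} _ _.

Notation "g '\o' f" := (comp g f) (at level 40, left associativity).

Definition is_iso {C : Category} {x y : C} (f : hom x y) : Prop :=
  exists g : hom y x, g \o f = idm x /\ f \o g = idm y.

Definition is_pushout {C : Category} {a b c p : C}
    (f : hom a b) (g : hom a c) (i : hom b p) (j : hom c p) : Prop :=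
  i \o f = j \o g /\
  forall (q : C) (k : hom b q) (l : hom c q), k \o f = l \o g ->
    exists! h : hom p q, h \o i = k /\ h \o j = l.

Definition is_pullback {C : Category} {a b c p : C}
    (f : hom b a) (g : hom c a) (i : hom p b) (j : hom p c) : Prop :=
  f \o i = g \o j /\
  forall (q : C) (k : hom q b) (l : hom q c), f \o k = g \o l ->
    exists! h : hom q p, i \o h = k /\ j \o h = l.

Record Pushouts (C : Category) := {
  po : forall a b c : C, hom a b -> hom a c -> C;
  po_inl : forall (a b c : C) (f : hom a b) (g : hom a c), hom b (po f g);
  po_inr : forall (a b c : C) (f : hom a b) (g : hom a c), hom c (po f g);
  po_is_pushout : forall (a b c : C) (f : hom a b) (g : hom a c),
    is_pushout f g (po_inl f g) (po_inr f g)
}.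

Record Pullbacks (C : Category) := {
  pb : forall a b c : C, hom b a -> hom c a -> C;
  pb_fst : forall (a b c : C) (f : hom b a) (g : hom c a), hom (pb f g) b;
  pb_snd : forall (a b c : C) (f : hom b a) (g : hom c a), hom (pb f g) c;
  pb_is_pullback : forall (a b c : C) (f : hom b a) (g : hom c a),
    is_pullback f g (pb_fst f g) (pb_snd f g)
}.

Definition po_copair {C : Category} (P : Pushouts C) {a b c q : C}
    {f : hom a b} {g : hom a c} {k : hom b q} {l : hom c q}
    (e : k \o f = l \o g) : hom (po P f g) q :=
  the (proj2 (po_is_pushout P f g) q k l e).

Definition pb_pair {C : Category} (P : Pullbacks C) {a b c q : C}
    {f : hom b a} {g : hom c a} {k : hom q b} {l : hom q c}
    (e : f \o k = g \o l) : hom q (pb P f g) :=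
  the (proj2 (pb_is_pullback P f g) q k l e).

(** * Functors, adjunctions, presheaves *)

Record Functor (C D : Category) := {
  fo :> C -> D;
  fmap : forall x y : C, hom x y -> hom (fo x) (fo y);
  fmap_id : forall x : C, fmap (idm x) = idm (fo x);
  fmap_comp : forall (x y z : C) (g : hom y z) (f : hom x y),
    fmap (g \o f) = fmap g \o fmap f
}.
Arguments fmap {_ _} _ {_ _} _.

Definition preserves_pushouts {C D : Category} (F : Functor C D) : Prop :=
  forall (a b c p : C) (f : hom a b) (g : hom a c) (i : hom b p) (j : hom c p),
    is_pushout f g i j -> is_pushout (fmap F f) (fmap F g) (fmap F i) (fmap F j).

Definition preserves_pullbacks {C D : Category} (F : Functor C D) : Prop :=
  forall (a b c p : C) (f : hom b a) (g : hom c a) (i : hom p b) (j : hom p c),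
    is_pullback f g i j -> is_pullback (fmap F f) (fmap F g) (fmap F i) (fmap F j).

Record RightAdjoint {C D : Category} (F : Functor C D) := {
  radj :> Functor D C;
  unit : forall c : C, hom c (radj (F c));
  counit : forall d : D, hom (F (radj d)) d;
  unit_nat : forall (c c' : C) (f : hom c c'),
    fmap radj (fmap F f) \o unit c = unit c' \o f;
  counit_nat : forall (d d' : D) (g : hom d d'),
    g \o counit d = counit d' \o fmap F (fmap radj g);
  triangle_l : forall c : C, counit (F c) \o fmap F (unit c) = idm (F c);
  triangle_r : forall d : D, fmap radj (counit d) \o unit (radj d) = idm (radj d)
}.

Definition transpose {C D : Category} {F : Functor C D} (R : RightAdjoint F)
    {c : C} {d : D} (f : hom (F c) d) : hom c (R d) :=
  fmap R f \o unit R c.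

Record Presheaf (C : Category) := {
  ps_ob :> C -> Type;
  ps_map : forall x y : C, hom x y -> ps_ob y -> ps_ob x;
  ps_id : forall (x : C) (s : ps_ob x), ps_map (idm x) s = s;
  ps_comp : forall (x y z : C) (g : hom y z) (f : hom x y) (s : ps_ob z),
    ps_map (g \o f) s = ps_map f (ps_map g s)
}.
Arguments ps_map {_} _ {_ _} _ _.

Definition representable {C : Category} (P : Presheaf C) : Prop :=
  exists (r : C) (eta : forall x : C, hom x r -> P x),
    (forall x, Bijective (eta x)) /\
    forall (x y : C) (t : hom x y) (s : hom y r),
      eta x (s \o t) = ps_map P t (eta y s).

Record SliceOb (B : Category) (I : B) := { sl_dom : B; sl_map :> hom sl_dom I }.

Record SliceHom {B : Category} {I : B} (u v : SliceOb I) := {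
  sl_hom :> hom (sl_dom u) (sl_dom v);
  sl_hom_tri : sl_map v \o sl_hom = sl_map u
}.

Lemma slice_hom_eq {B : Category} {I : B} {u v : SliceOb I} (s t : SliceHom u v) :
  sl_hom s = sl_hom t -> s = t.
Proof.
  destruct s as [s hs], t as [t ht]; simpl; intros ->.
  now rewrite (proof_irrelevance _ hs ht).
Qed.

Definition slice_id {B : Category} {I : B} (u : SliceOb I) : SliceHom u u :=
  {| sl_hom := idm (sl_dom u); sl_hom_tri := comp_id_r (sl_map u) |}.

Lemma slice_comp_tri {B : Category} {I : B} {u v w : SliceOb I}
    (t : SliceHom v w) (s : SliceHom u v) :
  sl_map w \o (sl_hom t \o sl_hom s) = sl_map u.
Proof. now rewrite comp_assoc, sl_hom_tri, sl_hom_tri. Qed.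

Definition slice_comp {B : Category} {I : B} {u v w : SliceOb I}
    (t : SliceHom v w) (s : SliceHom u v) : SliceHom u w :=
  {| sl_hom := sl_hom t \o sl_hom s; sl_hom_tri := slice_comp_tri t s |}.

Definition Slice (B : Category) (I : B) : Category.
Proof.
  refine {| ob := SliceOb I; hom := @SliceHom B I; idm := slice_id;
            comp := @slice_comp B I |}.
  - intros x y f; apply slice_hom_eq; apply comp_id_l.
  - intros x y f; apply slice_hom_eq; apply comp_id_r.
  - intros x y z w h g f; apply slice_hom_eq; apply comp_assoc.
Defined.

(** * Finite limits and the cartesian monoidal structure *)

Definition finite_category (D : Category) : Prop :=
  Finite D /\ forall x y : D, Finite (hom x y).

Record Cone {D B : Category} (F : Functor D B) := {
  apex : B;
  leg : forall d : D, hom apex (F d);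
  leg_nat : forall (d d' : D) (s : hom d d'), fmap F s \o leg d = leg d'
}.

Definition is_limit {D B : Category} {F : Functor D B} (c : Cone F) : Prop :=
  forall c' : Cone F, exists! h : hom (apex c') (apex c),
    forall d, leg c d \o h = leg c' d.

Definition has_finite_limits (B : Category) : Prop :=
  forall (D : Category) (F : Functor D B), finite_category D ->
    exists c : Cone F, is_limit c.

Class Cartesian (B : Category) := {
  one : B;
  bang : forall I : B, hom I one;
  bang_unique : forall (I : B) (u v : hom I one), u = v;
  cprod : B -> B -> B;
  pr1 : forall {I J : B}, hom (cprod I J) I;
  pr2 : forall {I J : B}, hom (cprod I J) J;
  pair : forall {K I J : B}, hom K I -> hom K J -> hom K (cprod I J);
  pr1_pair : forall (K I J : B) (u : hom K I) (v : hom K J), pr1 \o pair u v = u;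
  pr2_pair : forall (K I J : B) (u : hom K I) (v : hom K J), pr2 \o pair u v = v;
  pair_eta : forall (K I J : B) (w : hom K (cprod I J)),
    pair (pr1 \o w) (pr2 \o w) = w
}.

Definition cmap {B : Category} `{Cartesian B} {I I' J J' : B}
    (u : hom I I') (v : hom J J') : hom (cprod I J) (cprod I' J') :=
  pair (u \o pr1) (v \o pr2).

Definition diag {B : Category} `{Cartesian B} (I : B) : hom I (cprod I I) :=
  pair (idm I) (idm I).

Definition cassoc {B : Category} `{Cartesian B} (I J K : B) :
    hom (cprod (cprod I J) K) (cprod I (cprod J K)) :=
  pair (pr1 \o pr1) (pair (pr2 \o pr1) pr2).

Lemma pair_ext {B : Category} `{Cartesian B} {K I J : B} (w w' : hom K (cprod I J)) :
  pr1 \o w = pr1 \o w' -> pr2 \o w = pr2 \o w' -> w = w'.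
Proof.
  intros h1 h2. rewrite <- (pair_eta w), <- (pair_eta w'). now rewrite h1, h2.
Qed.

Lemma diag_nat {B : Category} `{Cartesian B} {I J : B} (u : hom I J) :
  cmap u u \o diag I = diag J \o u.
Proof.
  unfold cmap, diag; apply pair_ext; rewrite !comp_assoc.
  - rewrite !pr1_pair, <- comp_assoc, pr1_pair, comp_id_l, comp_id_r; reflexivity.
  - rewrite !pr2_pair, <- comp_assoc, pr2_pair, comp_id_l, comp_id_r; reflexivity.
Qed.

(** * Functors into a base, presented by their fibres *)

(* A functor p into B is given by its objects sorted by their image, so that
   [E I] is the class of objects X with p X = I, together with all morphisms
   between such objects and the action [proj] of p on morphisms.  The category
   and the functor themselves are [total E] and [projection E].  Every functor
   has this form, with [E I := {X | p X = I}]. *)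
Record CatOver (B : Category) := {
  fob :> B -> Type;
  mor : forall I J : B, fob I -> fob J -> Type;
  proj : forall (I J : B) (X : fob I) (Y : fob J), mor X Y -> hom I J;
  mid : forall (I : B) (X : fob I), mor X X;
  mcomp : forall (I J K : B) (X : fob I) (Y : fob J) (Z : fob K),
    mor Y Z -> mor X Y -> mor X Z;
  mcomp_id_l : forall (I J : B) (X : fob I) (Y : fob J) (f : mor X Y),
    mcomp (mid Y) f = f;
  mcomp_id_r : forall (I J : B) (X : fob I) (Y : fob J) (f : mor X Y),
    mcomp f (mid X) = f;
  mcomp_assoc : forall (I J K L : B) (X : fob I) (Y : fob J) (Z : fob K) (W : fob L)
      (h : mor Z W) (g : mor Y Z) (f : mor X Y),
    mcomp h (mcomp g f) = mcomp (mcomp h g) f;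
  proj_id : forall (I : B) (X : fob I), proj (mid X) = idm I;
  proj_comp : forall (I J K : B) (X : fob I) (Y : fob J) (Z : fob K)
      (g : mor Y Z) (f : mor X Y),
    proj (mcomp g f) = proj g \o proj f
}.
Arguments mor {_ _ _ _} _ _.
Arguments proj {_ _ _ _ _ _} _.
Arguments mid {_ _ _} _.
Arguments mcomp {_ _ _ _ _ _ _ _} _ _.

Notation "g '\m' f" := (mcomp g f) (at level 40, left associativity).

Definition total {B : Category} (E : CatOver B) : Category :=
  {| ob := {I : B & E I};
     hom := fun X Y => mor (projT2 X) (projT2 Y);
     idm := fun X => mid (projT2 X);
     comp := fun X Y Z g f => g \m f;
     comp_id_l := fun X Y f => mcomp_id_l f;
     comp_id_r := fun X Y f => mcomp_id_r f;
     comp_assoc := fun X Y Z W h g f => mcomp_assoc h g f |}.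

Definition projection {B : Category} (E : CatOver B) : Functor (total E) B :=
  {| fo := fun X : total E => projT1 X;
     fmap := fun (X Y : total E) (f : hom X Y) => proj (f : mor (projT2 X) (projT2 Y));
     fmap_id := fun X => proj_id (projT2 X);
     fmap_comp := fun (X Y Z : total E) g f =>
       proj_comp (Z := projT2 Z) (g : mor (projT2 Y) (projT2 Z)) f |}.

Record over {B : Category} {E : CatOver B} {I J : B} (u : hom I J)
    (X : E I) (Y : E J) := Over {
  omor :> mor X Y;
  oproj : proj omor = u
}.
Arguments Over {_ _ _ _ _ _ _} _ _.
Arguments omor {_ _ _ _ _ _ _} _.
Arguments oproj {_ _ _ _ _ _ _} _.

Lemma over_eq {B : Category} {E : CatOver B} {I J : B} {u : hom I J}
    {X : E I} {Y : E J} (f g : over u X Y) : omor f = omor g -> f = g.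
Proof.
  destruct f as [f hf], g as [g hg]; simpl; intros ->.
  now rewrite (proof_irrelevance _ hf hg).
Qed.

Lemma vert_comp_proj {B : Category} {E : CatOver B} {I : B} {X Y Z : E I}
    (g : over (idm I) Y Z) (f : over (idm I) X Y) :
  proj (omor g \m omor f) = idm I.
Proof. now rewrite proj_comp, !oproj, comp_id_l. Qed.

Definition fibre {B : Category} (E : CatOver B) (I : B) : Category.
Proof.
  refine {| ob := E I; hom := fun X Y => over (idm I) X Y;
            idm := fun X => Over (mid X) (proj_id X);
            comp := fun X Y Z g f => Over (omor g \m omor f) (vert_comp_proj g f) |}.
  - intros X Y f; apply over_eq; apply mcomp_id_l.
  - intros X Y f; apply over_eq; apply mcomp_id_r.
  - intros X Y Z W h g f; apply over_eq; apply mcomp_assoc.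
Defined.

(** * Cloven fibrations *)

Definition is_cartesian {B : Category} {E : CatOver B} {I J : B} {X : E I} {Y : E J}
    (f : mor X Y) : Prop :=
  forall (K : B) (Z : E K) (w : hom K I) (g : mor Z Y), proj g = proj f \o w ->
    exists! h : over w Z X, f \m omor h = g.

(* A functor together with a cleavage is a cloven fibration; [reind u] is u^*. *)
Class Cleavage {B : Category} (E : CatOver B) := {
  reind : forall {I J : B}, hom I J -> E J -> E I;
  lift : forall {I J : B} (u : hom I J) (Y : E J), over u (reind u Y) Y;
  lift_cartesian : forall (I J : B) (u : hom I J) (Y : E J), is_cartesian (lift u Y)
}.

Lemma factor_ex {B : Category} {E : CatOver B} `{Cleavage B E} {I J K : B}
    (u : hom I J) (Y : E J) {Z : E K} (w : hom K I) (g : mor Z Y)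
    (e : proj g = u \o w) :
  exists! h : over w Z (reind u Y), lift u Y \m h = g.
Proof. apply lift_cartesian. now rewrite oproj. Qed.

Definition factor {B : Category} {E : CatOver B} `{Cleavage B E} {I J K : B}
    (u : hom I J) (Y : E J) {Z : E K} (w : hom K I) (g : mor Z Y)
    (e : proj g = u \o w) : over w Z (reind u Y) :=
  the (factor_ex e).

Lemma lift_factor {B : Category} {E : CatOver B} `{Cleavage B E} {I J K : B}
    (u : hom I J) (Y : E J) {Z : E K} (w : hom K I) (g : mor Z Y)
    (e : proj g = u \o w) :
  lift u Y \m factor e = g.
Proof. exact (the_spec (factor_ex e)). Qed.

Lemma factor_unique {B : Category} {E : CatOver B} `{Cleavage B E} {I J K : B}
    (u : hom I J) (Y : E J) {Z : E K} (w : hom K I) (h h' : over w Z (reind u Y)) :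
  lift u Y \m h = lift u Y \m h' -> h = h'.
Proof.
  intros eq.
  assert (e : proj (lift u Y \m h) = u \o w) by now rewrite proj_comp, !oproj.
  destruct (factor_ex e) as [k [_ hk]].
  rewrite <- (hk h eq_refl). apply hk. now symmetry.
Qed.

Lemma canon_proj {B : Category} {E : CatOver B} `{Cleavage B E} {K K' I : B}
    {u : hom K I} {t : hom K' K} {v : hom K' I} (e : v = u \o t) (Y : E I) :
  proj (lift v Y) = u \o t.
Proof. now rewrite oproj. Qed.

(* The canonical cartesian map v^* Y -> u^* Y over t, where v = u t. *)
Definition canon {B : Category} {E : CatOver B} `{Cleavage B E} {K K' I : B}
    {u : hom K I} {t : hom K' K} {v : hom K' I} (e : v = u \o t) (Y : E I) :
    over t (reind v Y) (reind u Y) :=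
  factor (canon_proj e Y).

Lemma reind_map_proj {B : Category} {E : CatOver B} `{Cleavage B E} {I J : B}
    (u : hom I J) {X Y : E J} (f : over (idm J) X Y) :
  proj (f \m lift u X) = u \o idm I.
Proof. now rewrite proj_comp, !oproj, comp_id_l, comp_id_r. Qed.

Definition reind_map {B : Category} {E : CatOver B} `{Cleavage B E} {I J : B}
    (u : hom I J) {X Y : E J} (f : over (idm J) X Y) :
    over (idm I) (reind u X) (reind u Y) :=
  factor (reind_map_proj u f).

Lemma lift_reind_map {B : Category} {E : CatOver B} `{Cleavage B E} {I J : B}
    (u : hom I J) {X Y : E J} (f : over (idm J) X Y) :
  lift u Y \m reind_map u f = f \m lift u X.
Proof. apply lift_factor. Qed.

Definition reindexing {B : Category} {E : CatOver B} `{Cleavage B E} {I J : B}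
    (u : hom I J) : Functor (fibre E J) (fibre E I).
Proof.
  refine (@Build_Functor (fibre E J) (fibre E I) (fun X => reind u X)
            (fun X Y f => reind_map u f) _ _).
  - intros X; apply factor_unique; rewrite lift_reind_map; simpl.
    now rewrite mcomp_id_l, mcomp_id_r.
  - intros X Y Z g f; apply factor_unique; simpl.
    rewrite lift_reind_map, mcomp_assoc, lift_reind_map, <- mcomp_assoc.
    rewrite lift_reind_map; simpl. now rewrite mcomp_assoc.
Defined.

Class FibredPushouts {B : Category} (E : CatOver B) `{Cleavage B E} := {
  fpo : forall I : B, Pushouts (fibre E I);
  fpo_stable : forall (I J : B) (u : hom I J), preserves_pushouts (reindexing (E := E) u)
}.
Arguments FibredPushouts {_} _ {_}.

Class FibredPullbacks {B : Category} (E : CatOver B) `{Cleavage B E} := {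
  fpb : forall I : B, Pullbacks (fibre E I);
  fpb_stable : forall (I J : B) (u : hom I J), preserves_pullbacks (reindexing (E := E) u)
}.
Arguments FibredPullbacks {_} _ {_}.

(** * Local smallness *)

Lemma lift_canon {B : Category} {E : CatOver B} `{Cleavage B E} {K K' I : B}
    {u : hom K I} {t : hom K' K} {v : hom K' I} (e : v = u \o t) (Y : E I) :
  lift u Y \m canon e Y = lift v Y.
Proof. apply lift_factor. Qed.

Lemma canon_cartesian {B : Category} {E : CatOver B} `{Cleavage B E} {K K' I : B}
    {u : hom K I} {t : hom K' K} {v : hom K' I} (e : v = u \o t) (Y : E I) :
  is_cartesian (canon e Y).
Proof.
  intros L Z w g eg. rewrite oproj in eg.
  assert (e' : proj (lift u Y \m g) = v \o w)
    by now rewrite proj_comp, oproj, eg, e, comp_assoc.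
  exists (factor e'). split.
  - assert (e1 : proj (canon e Y \m factor e') = t \o w)
      by now rewrite proj_comp, !oproj.
    assert (h : Over _ e1 = Over _ eg).
    { apply factor_unique; simpl. rewrite mcomp_assoc, lift_canon. apply lift_factor. }
    exact (f_equal omor h).
  - intros k hk. apply factor_unique.
    rewrite lift_factor, <- hk, mcomp_assoc, lift_canon. reflexivity.
Qed.

Lemma canon_id {B : Category} {E : CatOver B} `{Cleavage B E} {K I : B}
    {u : hom K I} (e : u = u \o idm K) (Y : E I) :
  omor (canon e Y) = mid (reind u Y).
Proof.
  assert (h : canon e Y = Over _ (proj_id (reind u Y))).
  { apply factor_unique; simpl. now rewrite lift_canon, mcomp_id_r. }
  now rewrite h.
Qed.

Lemma canon_comp {B : Category} {E : CatOver B} `{Cleavage B E} {K K' K'' I : B}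
    {u : hom K I} {t : hom K' K} {v : hom K' I} {s : hom K'' K'} {w : hom K'' I}
    (e : v = u \o t) (e' : w = v \o s) (e'' : w = u \o (t \o s)) (Y : E I) :
  omor (canon e'' Y) = canon e Y \m canon e' Y.
Proof.
  assert (e1 : proj (canon e Y \m canon e' Y) = t \o s)
    by now rewrite proj_comp, !oproj.
  assert (h : canon e'' Y = Over _ e1).
  { apply factor_unique; simpl. now rewrite mcomp_assoc, !lift_canon. }
  now rewrite h.
Qed.

Lemma hom_psh_ex {B : Category} {E : CatOver B} `{Cleavage B E} {I : B} (X Y : E I)
    {u v : Slice I} (t : hom u v)
    (f : over (idm (sl_dom v)) (reind (sl_map v) X) (reind (sl_map v) Y)) :
  exists! f' : over (idm (sl_dom u)) (reind (sl_map u) X) (reind (sl_map u) Y),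
    canon (eq_sym (sl_hom_tri t)) Y \m f' = f \m canon (eq_sym (sl_hom_tri t)) X.
Proof.
  apply canon_cartesian. now rewrite proj_comp, !oproj, comp_id_l, comp_id_r.
Qed.

(* The functor u |-> E_J(u^* X, u^* Y) on (B/I)^op: along t, a vertical map f is
   sent to the vertical f' commuting with f over the canonical cartesian maps. *)
Definition hom_presheaf {B : Category} {E : CatOver B} `{Cleavage B E} {I : B}
    (X Y : E I) : Presheaf (Slice I).
Proof.
  refine (@Build_Presheaf (Slice I)
    (fun u => over (idm (sl_dom u)) (reind (sl_map u) X) (reind (sl_map u) Y))
    (fun u v t f => the (hom_psh_ex (u := u) (v := v) t f)) _ _).
  - intros u f. apply the_unique. cbn. now rewrite !canon_id, mcomp_id_l, mcomp_id_r.
  - intros u v w t s f. apply the_unique.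
    pose proof (the_spec (hom_psh_ex t f)) as h1; cbv beta in h1.
    set (f1 := the (hom_psh_ex t f)) in *.
    pose proof (the_spec (hom_psh_ex s f1)) as h2; cbv beta in h2.
    set (f2 := the (hom_psh_ex s f1)) in *.
    rewrite !(canon_comp (eq_sym (sl_hom_tri t)) (eq_sym (sl_hom_tri s))
                (eq_sym (sl_hom_tri (t \o s)))).
    now rewrite <- mcomp_assoc, h2, mcomp_assoc, h1, mcomp_assoc.
Defined.

Definition locally_small {B : Category} (E : CatOver B) `{Cleavage B E} : Prop :=
  forall (I : B) (X Y : E I), representable (hom_presheaf X Y).
Arguments locally_small {_} _ {_}.

(** * The fibration of vertical maps *)

Record VertMap {B : Category} (E : CatOver B) (I : B) := {
  vdom : E I;
  vcod : E I;
  vmap :> over (idm I) vdom vcod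
}.
Arguments vdom {_ _ _} _.
Arguments vcod {_ _ _} _.
Arguments vmap {_ _ _} _.

Record Square {B : Category} {E : CatOver B} {I J : B}
    (a : VertMap E I) (b : VertMap E J) := {
  sq_dom : mor (vdom a) (vdom b);
  sq_cod : mor (vcod a) (vcod b);
  sq_comm : vmap b \m sq_dom = sq_cod \m vmap a
}.

Lemma square_eq {B : Category} {E : CatOver B} {I J : B}
    {a : VertMap E I} {b : VertMap E J} (s t : Square a b) :
  sq_dom s = sq_dom t -> sq_cod s = sq_cod t -> s = t.
Proof.
  destruct s as [s0 s1 hs], t as [t0 t1 ht]; simpl; intros -> ->.
  now rewrite (proof_irrelevance _ hs ht).
Qed.

Lemma sq_dom_proj {B : Category} {E : CatOver B} {I J : B}
    {a : VertMap E I} {b : VertMap E J} (s : Square a b) :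
  proj (sq_dom s) = proj (sq_cod s).
Proof.
  pose proof (f_equal proj (sq_comm s)) as h.
  now rewrite !proj_comp, !oproj, comp_id_l, comp_id_r in h.
Qed.

Definition sq_id {B : Category} {E : CatOver B} {I : B} (a : VertMap E I) : Square a a.
Proof.
  refine {| sq_dom := mid (vdom a); sq_cod := mid (vcod a) |}.
  now rewrite mcomp_id_l, mcomp_id_r.
Defined.

Definition sq_comp {B : Category} {E : CatOver B} {I J K : B} {a : VertMap E I}
    {b : VertMap E J} {c : VertMap E K} (t : Square b c) (s : Square a b) : Square a c.
Proof.
  refine {| sq_dom := sq_dom t \m sq_dom s; sq_cod := sq_cod t \m sq_cod s |}.
  now rewrite mcomp_assoc, sq_comm, <- mcomp_assoc, sq_comm, mcomp_assoc.
Defined.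

(* V(E).  The two sides of a square lie over the same map, by [sq_dom_proj]. *)
Definition Vert {B : Category} (E : CatOver B) : CatOver B.
Proof.
  refine (@Build_CatOver B (VertMap E) (@Square B E)
            (fun I J a b s => proj (sq_cod s)) (@sq_id B E) (@sq_comp B E) _ _ _ _ _).
  - intros; apply square_eq; apply mcomp_id_l.
  - intros; apply square_eq; apply mcomp_id_r.
  - intros; apply square_eq; apply mcomp_assoc.
  - intros; apply proj_id.
  - intros; apply proj_comp.
Defined.

Definition vreind {B : Category} {E : CatOver B} `{Cleavage B E} {I J : B}
    (u : hom I J) (a : Vert E J) : Vert E I :=
  {| vdom := reind u (vdom a); vcod := reind u (vcod a);
     vmap := reind_map u (vmap a) |}.

Definition vlift_sq {B : Category} {E : CatOver B} `{Cleavage B E} {I J : B}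
    (u : hom I J) (a : Vert E J) : mor (vreind u a) a :=
  {| sq_dom := lift u (vdom a) : mor (vdom (vreind u a)) (vdom a);
     sq_cod := lift u (vcod a) : mor (vcod (vreind u a)) (vcod a);
     sq_comm := eq_sym (lift_reind_map u (vmap a)) |}.

Definition vlift {B : Category} {E : CatOver B} `{Cleavage B E} {I J : B}
    (u : hom I J) (a : Vert E J) : over u (vreind u a) a :=
  @Over B (Vert E) I J u (vreind u a) a (vlift_sq u a) (oproj (lift u (vcod a))).

Lemma vlift_cartesian {B : Category} {E : CatOver B} `{Cleavage B E} {I J : B}
    (u : hom I J) (a : Vert E J) : is_cartesian (vlift u a).
Proof.
  intros K c w g eg. simpl in eg. rewrite oproj in eg.
  assert (eg0 : proj (sq_dom g) = u \o w) by now rewrite sq_dom_proj.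
  pose (h0 := factor eg0). pose (h1 := factor eg).
  assert (hc : vmap (vreind u a) \m h0 = h1 \m vmap c).
  { assert (e0 : proj (vmap (vreind u a) \m h0) = w)
      by now rewrite proj_comp, !oproj, comp_id_l.
    assert (e1 : proj (h1 \m vmap c) = w)
      by now rewrite proj_comp, !oproj, comp_id_r.
    assert (h : Over _ e0 = Over _ e1).
    { apply factor_unique; simpl. unfold h0, h1.
      rewrite !mcomp_assoc, lift_reind_map, <- mcomp_assoc, !lift_factor.
      apply sq_comm. }
    exact (f_equal omor h). }
  pose (s := @Build_Square B E K I c (vreind u a) h0 h1 hc
             : mor (c : Vert E K) (vreind u a : Vert E I)).
  assert (hs : proj s = w) by apply oproj.
  exists (Over s hs). split.
  - apply square_eq; simpl; apply lift_factor.
  - intros [k hk] e. apply over_eq. simpl.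
    pose proof (f_equal sq_dom e) as ed. pose proof (f_equal sq_cod e) as ec.
    simpl in ed, ec, hk.
    assert (hk0 : proj (sq_dom k) = w) by now rewrite sq_dom_proj.
    apply square_eq; simpl.
    + assert (h : h0 = Over _ hk0).
      { apply factor_unique; simpl. unfold h0. rewrite lift_factor. now symmetry. }
      now rewrite h.
    + assert (h : h1 = Over _ hk).
      { apply factor_unique; simpl. unfold h1. rewrite lift_factor. now symmetry. }
      now rewrite h.
Qed.

#[export] Instance Vert_cleavage {B : Category} {E : CatOver B} `{Cleavage B E} :
    Cleavage (Vert E) := {|
  reind := fun I J u a => vreind u a;
  lift := fun I J u a => vlift u a;
  lift_cartesian := fun I J u a => @vlift_cartesian B E _ I J u a
|}.

(** * Cartesian monoidal fibrations *)

(* A monoidal structure on the total category, strictly preserved by p when B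
   carries its cartesian monoidal structure, whose tensor product preserves
   cartesian maps. *)
Class CartMonoidal {B : Category} `{Cartesian B} (E : CatOver B) := {
  tens : forall {I J : B}, E I -> E J -> E (cprod I J);
  tmap : forall {I I' J J' : B} {X : E I} {X' : E I'} {Y : E J} {Y' : E J'},
    mor X X' -> mor Y Y' -> mor (tens X Y) (tens X' Y');
  tmap_id : forall (I J : B) (X : E I) (Y : E J),
    tmap (mid X) (mid Y) = mid (tens X Y);
  tmap_comp : forall (I I' I'' J J' J'' : B)
      (X : E I) (X' : E I') (X'' : E I'') (Y : E J) (Y' : E J') (Y'' : E J'')
      (f' : mor X' X'') (f : mor X X') (g' : mor Y' Y'') (g : mor Y Y'),
    tmap (f' \m f) (g' \m g) = tmap f' g' \m tmap f g;
  tunit : E one;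
  tassoc : forall (I J K : B) (X : E I) (Y : E J) (Z : E K),
    mor (tens (tens X Y) Z) (tens X (tens Y Z));
  tassoc_inv : forall (I J K : B) (X : E I) (Y : E J) (Z : E K),
    mor (tens X (tens Y Z)) (tens (tens X Y) Z);
  tlunit : forall (I : B) (X : E I), mor (tens tunit X) X;
  tlunit_inv : forall (I : B) (X : E I), mor X (tens tunit X);
  trunit : forall (I : B) (X : E I), mor (tens X tunit) X;
  trunit_inv : forall (I : B) (X : E I), mor X (tens X tunit);
  tassocK : forall (I J K : B) (X : E I) (Y : E J) (Z : E K),
    tassoc_inv X Y Z \m tassoc X Y Z = mid _;
  tassoc_invK : forall (I J K : B) (X : E I) (Y : E J) (Z : E K),
    tassoc X Y Z \m tassoc_inv X Y Z = mid _;
  tlunitK : forall (I : B) (X : E I), tlunit_inv X \m tlunit X = mid _;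
  tlunit_invK : forall (I : B) (X : E I), tlunit X \m tlunit_inv X = mid _;
  trunitK : forall (I : B) (X : E I), trunit_inv X \m trunit X = mid _;
  trunit_invK : forall (I : B) (X : E I), trunit X \m trunit_inv X = mid _;
  tassoc_nat : forall (I I' J J' K K' : B)
      (X : E I) (X' : E I') (Y : E J) (Y' : E J') (Z : E K) (Z' : E K')
      (f : mor X X') (g : mor Y Y') (h : mor Z Z'),
    tassoc X' Y' Z' \m tmap (tmap f g) h = tmap f (tmap g h) \m tassoc X Y Z;
  tlunit_nat : forall (I I' : B) (X : E I) (X' : E I') (f : mor X X'),
    tlunit X' \m tmap (mid tunit) f = f \m tlunit X;
  trunit_nat : forall (I I' : B) (X : E I) (X' : E I') (f : mor X X'),
    trunit X' \m tmap f (mid tunit) = f \m trunit X;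
  pentagon : forall (I J K L : B) (X : E I) (Y : E J) (Z : E K) (W : E L),
    tassoc X Y (tens Z W) \m tassoc (tens X Y) Z W =
    tmap (mid X) (tassoc Y Z W) \m tassoc X (tens Y Z) W
      \m tmap (tassoc X Y Z) (mid W);
  triangle : forall (I J : B) (X : E I) (Y : E J),
    tmap (mid X) (tlunit Y) \m tassoc X tunit Y = tmap (trunit X) (mid Y);
  proj_tmap : forall (I I' J J' : B) (X : E I) (X' : E I') (Y : E J) (Y' : E J')
      (f : mor X X') (g : mor Y Y'),
    proj (tmap f g) = cmap (proj f) (proj g);
  proj_tassoc : forall (I J K : B) (X : E I) (Y : E J) (Z : E K),
    proj (tassoc X Y Z) = cassoc I J K;
  proj_tlunit : forall (I : B) (X : E I), proj (tlunit X) = pr2;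
  proj_trunit : forall (I : B) (X : E I), proj (trunit X) = pr1;
  tmap_cartesian : forall (I I' J J' : B)
      (X : E I) (X' : E I') (Y : E J) (Y' : E J') (f : mor X X') (g : mor Y Y'),
    is_cartesian f -> is_cartesian g -> is_cartesian (tmap f g)
}.

Definition ftens {B : Category} {E : CatOver B} `{Cartesian B} `{Cleavage B E}
    `{!CartMonoidal E} {I : B} (X Y : E I) : E I :=
  reind (diag I) (tens X Y).

Lemma ftmap_proj {B : Category} {E : CatOver B} `{Cartesian B} `{Cleavage B E}
    `{!CartMonoidal E} {I J : B} (u : hom I J) {X Y : E I} {X' Y' : E J}
    (f : over u X X') (g : over u Y Y') :
  proj (tmap f g \m lift (diag I) (tens X Y)) = diag J \o u.
Proof. now rewrite proj_comp, proj_tmap, !oproj, diag_nat. Qed.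

(* The action of the fibrewise tensor product on a pair of maps over u. *)
Definition ftmap {B : Category} {E : CatOver B} `{Cartesian B} `{Cleavage B E}
    `{!CartMonoidal E} {I J : B} {u : hom I J} {X Y : E I} {X' Y' : E J}
    (f : over u X X') (g : over u Y Y') : over u (ftens X Y) (ftens X' Y') :=
  factor (ftmap_proj f g).

Lemma lift_ftmap {B : Category} {E : CatOver B} `{Cartesian B} `{Cleavage B E}
    `{!CartMonoidal E} {I J : B} {u : hom I J} {X Y : E I} {X' Y' : E J}
    (f : over u X X') (g : over u Y Y') :
  lift (diag J) (tens X' Y') \m ftmap f g = tmap f g \m lift (diag I) (tens X Y).
Proof. apply lift_factor. Qed.

Lemma ftens_ext {B : Category} {E : CatOver B} `{Cartesian B} `{Cleavage B E}
    `{!CartMonoidal E} {I J : B} {u : hom J I} {X Y : E I} {Z : E J}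
    (h h' : over u Z (ftens X Y)) :
  lift (diag I) (tens X Y) \m h = lift (diag I) (tens X Y) \m h' -> h = h'.
Proof. apply factor_unique. Qed.

Lemma ftmap_id {B : Category} {E : CatOver B} `{Cartesian B} `{Cleavage B E}
    `{!CartMonoidal E} {I : B} (X Y : E I) :
  ftmap (Over (mid X) (proj_id X)) (Over (mid Y) (proj_id Y))
  = Over (mid (ftens X Y)) (proj_id (ftens X Y)).
Proof.
  apply ftens_ext; rewrite lift_ftmap; simpl.
  now rewrite tmap_id, mcomp_id_l, mcomp_id_r.
Qed.

Lemma ftmap_comp {B : Category} {E : CatOver B} `{Cartesian B} `{Cleavage B E}
    `{!CartMonoidal E} {I J K : B} {u : hom I J} {v : hom J K} {w : hom I K}
    {X Y : E I} {X' Y' : E J} {X'' Y'' : E K}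
    (f' : over v X' X'') (g' : over v Y' Y'') (f : over u X X') (g : over u Y Y')
    (f'' : over w X X'') (g'' : over w Y Y'') :
  omor f'' = f' \m f -> omor g'' = g' \m g ->
  omor (ftmap f'' g'') = ftmap f' g' \m ftmap f g.
Proof.
  intros ef eg.
  assert (ew : w = v \o u) by now rewrite <- (oproj f''), ef, proj_comp, !oproj.
  assert (e : proj (ftmap f' g' \m ftmap f g) = w)
    by now rewrite proj_comp, !oproj.
  assert (h : ftmap f'' g'' = Over _ e).
  { apply ftens_ext; rewrite lift_ftmap, ef, eg, tmap_comp, <- mcomp_assoc.
    rewrite <- (lift_ftmap f g), mcomp_assoc, <- (lift_ftmap f' g').
    symmetry; apply mcomp_assoc. }
  now rewrite h.
Qed.

(* X (x)_I - and - (x)_I X as endofunctors of the fibre over I. *)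
Definition tensl {B : Category} {E : CatOver B} `{Cartesian B} `{Cleavage B E}
    `{!CartMonoidal E} {I : B} (X : E I) : Functor (fibre E I) (fibre E I).
Proof.
  refine (@Build_Functor (fibre E I) (fibre E I) (fun Y => ftens X Y)
    (fun Y Y' g => ftmap (Over (mid X) (proj_id X)) g) _ _).
  - intros Y. apply ftmap_id.
  - intros Y Y' Y'' g' g. apply over_eq. apply ftmap_comp; simpl; [|reflexivity].
    now rewrite mcomp_id_l.
Defined.

Definition tensr {B : Category} {E : CatOver B} `{Cartesian B} `{Cleavage B E}
    `{!CartMonoidal E} {I : B} (X : E I) : Functor (fibre E I) (fibre E I).
Proof.
  refine (@Build_Functor (fibre E I) (fibre E I) (fun Y => ftens Y X)
    (fun Y Y' g => ftmap g (Over (mid X) (proj_id X))) _ _).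
  - intros Y. apply ftmap_id.
  - intros Y Y' Y'' g' g. apply over_eq. apply ftmap_comp; simpl; [reflexivity|].
    now rewrite mcomp_id_l.
Defined.

Lemma ftcomp_proj {B : Category} {E : CatOver B} `{Cartesian B} `{Cleavage B E}
    `{!CartMonoidal E} {I J : B} (u : hom I J) (X Y : E J) :
  proj (ftmap (lift u X) (lift u Y)) = u \o idm I.
Proof. now rewrite oproj, comp_id_r. Qed.

(* The canonical comparison u^* X (x)_I u^* Y -> u^* (X (x)_J Y). *)
Definition ftcomp {B : Category} {E : CatOver B} `{Cartesian B} `{Cleavage B E}
    `{!CartMonoidal E} {I J : B} (u : hom I J) (X Y : E J) :
    over (idm I) (ftens (reind u X) (reind u Y)) (reind u (ftens X Y)) :=
  factor (ftcomp_proj u X Y).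

(* Reindexing preserves the right adjoints: the canonical maps
   u^* (R_X Y) -> R_{u^* X} (u^* Y) are invertible. *)
Class InternallyClosed {B : Category} (E : CatOver B) `{Cartesian B} `{Cleavage B E}
    `{!CartMonoidal E} := {
  lhom : forall (I : B) (X : E I), RightAdjoint (tensl X);
  rhom : forall (I : B) (X : E I), RightAdjoint (tensr X);
  lhom_stable : forall (I J : B) (u : hom I J) (X Y : E J),
    is_iso (transpose (lhom (reind u X))
      (fmap (reindexing u) (counit (lhom X) Y)
         \o (ftcomp u X (lhom X Y) : @hom (fibre E I) _ _)));
  rhom_stable : forall (I J : B) (u : hom I J) (X Y : E J),
    is_iso (transpose (rhom (reind u X))
      (fmap (reindexing u) (counit (rhom X) Y)
         \o (ftcomp u (rhom X Y) X : @hom (fibre E I) _ _)))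
}.
Arguments InternallyClosed {_} _ {_ _ _}.

(** * Pushout product and pullback cotensor *)

Lemma tens_interchange {B : Category} {E : CatOver B} `{Cartesian B} `{Cleavage B E}
    `{!CartMonoidal E} {I : B} {X X' Y Y' : E I}
    (g : @hom (fibre E I) X X') (g' : @hom (fibre E I) Y Y') :
  fmap (tensr Y') g \o fmap (tensl X) g' = fmap (tensl X') g' \o fmap (tensr Y) g.
Proof.
  apply over_eq. transitivity (omor (ftmap g g')); [symmetry|];
    apply ftmap_comp; simpl; now rewrite ?mcomp_id_l, ?mcomp_id_r.
Qed.

Section PushoutProduct.
Context {B : Category} {E : CatOver B} `{Cartesian B} `{Cleavage B E}.
Context `{!CartMonoidal E} `{!FibredPushouts E}.

Definition pprod_dom {I : B} (a b : Vert E I) : E I :=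
  po (fpo (E := E) I) (fmap (tensl (vdom a)) (vmap b))
                      (fmap (tensr (vdom b)) (vmap a)).

(* A (x) V -> dom and B (x) U -> dom, for a : A -> B and b : U -> V. *)
Definition pprod_inl {I : B} (a b : Vert E I) :
    over (idm I) (ftens (vdom a) (vcod b)) (pprod_dom a b) :=
  po_inl (fpo (E := E) I) (fmap (tensl (vdom a)) (vmap b))
                          (fmap (tensr (vdom b)) (vmap a)).

Definition pprod_inr {I : B} (a b : Vert E I) :
    over (idm I) (ftens (vcod a) (vdom b)) (pprod_dom a b) :=
  po_inr (fpo (E := E) I) (fmap (tensl (vdom a)) (vmap b))
                          (fmap (tensr (vdom b)) (vmap a)).

Definition pushout_product {I : B} (a b : Vert E I) : Vert E I := {|
  vdom := pprod_dom a b;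
  vcod := ftens (vcod a) (vcod b);
  vmap := po_copair (fpo (E := E) I) (tens_interchange (vmap a) (vmap b))
|}.

End PushoutProduct.

Section PullbackCotensor.
Context {B : Category} {E : CatOver B} `{Cartesian B} `{Cleavage B E}.
Context `{!CartMonoidal E} `{!InternallyClosed E} `{!FibredPullbacks E}.

(* cot X Y = {X, Y}_I, contravariant in X via [cot_pre]. *)
Definition cot {I : B} (X Y : E I) : E I := lhom X Y.

Definition cot_ev {I : B} (X Y : E I) : over (idm I) (ftens X (cot X Y)) Y :=
  counit (lhom X) Y.

Definition cot_post {I : B} (X : E I) {Y Y' : E I} (f : @hom (fibre E I) Y Y') :
    @hom (fibre E I) (cot X Y) (cot X Y') :=
  fmap (lhom X) f.

Definition cot_pre {I : B} {X X' : E I} (g : @hom (fibre E I) X X') (Y : E I) :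
    @hom (fibre E I) (cot X' Y) (cot X Y) :=
  transpose (lhom X) (counit (lhom X') Y \o fmap (tensr (cot X' Y)) g).

Lemma cot_interchange {I : B} {X X' Y Y' : E I}
    (g : @hom (fibre E I) X X') (f : @hom (fibre E I) Y Y') :
  cot_post X f \o cot_pre g Y = cot_pre g Y' \o cot_post X' f.
Proof.
  unfold cot_post, cot_pre, transpose, cot.
  set (k := counit (lhom X') Y \o fmap (tensr (lhom X' Y)) g).
  set (k' := counit (lhom X') Y' \o fmap (tensr (lhom X' Y')) g).
  assert (hk : f \o k = k' \o fmap (tensl X) (fmap (lhom X') f)).
  { unfold k, k'. rewrite comp_assoc, counit_nat, <- !comp_assoc. f_equal.
    symmetry. apply (tens_interchange g (fmap (lhom X') f)). }
  transitivity (fmap (lhom X) (f \o k) \o unit (lhom X) (lhom X' Y)).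
  { rewrite fmap_comp. apply comp_assoc. }
  rewrite hk, fmap_comp.
  transitivity (fmap (lhom X) k' \o (unit (lhom X) (lhom X' Y') \o fmap (lhom X') f)).
  - rewrite <- unit_nat. symmetry. apply comp_assoc.
  - apply comp_assoc.
Qed.

Definition pcot_cod {J : B} (a f : Vert E J) : E J :=
  pb (fpb (E := E) J) (cot_post (vdom a) (vmap f)) (cot_pre (vmap a) (vcod f)).

(* cod -> {A, X} and cod -> {B, Y}, for a : A -> B and f : X -> Y. *)
Definition pcot_fst {J : B} (a f : Vert E J) :
    over (idm J) (pcot_cod a f) (cot (vdom a) (vdom f)) :=
  pb_fst (fpb (E := E) J) (cot_post (vdom a) (vmap f)) (cot_pre (vmap a) (vcod f)).

Definition pcot_snd {J : B} (a f : Vert E J) :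
    over (idm J) (pcot_cod a f) (cot (vcod a) (vcod f)) :=
  pb_snd (fpb (E := E) J) (cot_post (vdom a) (vmap f)) (cot_pre (vmap a) (vcod f)).

Definition pullback_cotensor {J : B} (a f : Vert E J) : Vert E J := {|
  vdom := cot (vcod a) (vdom f);
  vcod := pcot_cod a f;
  vmap := pb_pair (fpb (E := E) J) (cot_interchange (vmap a) (vmap f))
|}.

End PullbackCotensor.

(** * Lifting problems *)

Record LiftingFamily {B : Category} {E : CatOver B} `{Cleavage B E} {I J : B}
    (n : Vert E I) (g : Vert E J) := {
  lf_ob : B;
  lf_l : hom lf_ob I;
  lf_r : hom lf_ob J;
  lf_sq : over lf_r (reind lf_l n) g
}.
Arguments lf_ob {_ _ _ _ _ _ _} _.
Arguments lf_l {_ _ _ _ _ _ _} _.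
Arguments lf_r {_ _ _ _ _ _ _} _.
Arguments lf_sq {_ _ _ _ _ _ _} _.

Record Solution {B : Category} {E : CatOver B} `{Cleavage B E} {I J : B}
    {n : Vert E I} {g : Vert E J} (F : LiftingFamily n g) := {
  sol :> over (lf_r F) (reind (lf_l F) (vcod n)) (vdom g);
  sol_upper : sol \m vmap (reind (lf_l F) n) = sq_dom (omor (lf_sq F));
  sol_lower : vmap g \m sol = sq_cod (omor (lf_sq F))
}.

Definition is_universal {B : Category} {E : CatOver B} `{Cleavage B E} {I J : B}
    {n : Vert E I} {g : Vert E J} (F : LiftingFamily n g) : Prop :=
  forall F' : LiftingFamily n g,
    exists! t : hom (lf_ob F') (lf_ob F),
      exists e : lf_l F' = lf_l F \o t,
        lf_r F' = lf_r F \o t /\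
        omor (lf_sq F') = lf_sq F \m canon e n.

(** * Transposition over the base *)

Section Transposition.
Context {B : Category} {E : CatOver B} `{Cartesian B} `{Cleavage B E}.
Context `{!CartMonoidal E} `{!InternallyClosed E}.
Context `{!FibredPushouts E} `{!FibredPullbacks E}.

Lemma bang_change_proj {I J K : B} (s : hom K I) (t : hom K J) (A : E one) :
  proj (lift (bang I) A \m lift s (reind (bang I) A)) = bang J \o t.
Proof. apply bang_unique. Qed.

(* The canonical map s^* I^* A -> J^* A over t. *)
Definition bang_change {I J K : B} (s : hom K I) (t : hom K J) (A : E one) :
    over t (reind s (reind (bang I) A)) (reind (bang J) A) :=
  factor (bang_change_proj s t A).

(* k : s^*(I^* A (x)_I U) -> X and k' : s^* U -> {J^* A, X}_J over t are
   transposes of each other: the canonical comparison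
   followed by k is the composite of k' with evaluation,
     s^* I^* A (x)_K s^* U -> J^* A (x)_J {J^* A, X}_J -> X. *)
Definition transposes {I J K : B} (s : hom K I) (t : hom K J)
    (A : E one) (U : E I) (X : E J)
    (k : mor (reind s (ftens (reind (bang I) A) U)) X)
    (k' : mor (reind s U) (cot (reind (bang J) A) X)) : Prop :=
  exists e : proj k' = t,
    k \m ftcomp s (reind (bang I) A) U
    = cot_ev (reind (bang J) A) X \m ftmap (bang_change s t A) (Over k' e).
Arguments transposes {_ _ _} s t A U X k k'.

(* Transposition of lifting problems over K, for a = (A -> B) over 1,
   n = (U -> V) and f = (X -> Y): h consists of A (x) V -> X and B (x) U -> X,
   agreeing on A (x) U, and B (x) V -> Y; h' consists of U -> {B, X},
   V -> {A, X} and V -> {B, Y}. *)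
Definition square_transposes {I J K : B} (s : hom K I) (t : hom K J)
    (a : Vert E one) (n : Vert E I) (f : Vert E J)
    (h : mor (reind s (pushout_product (reind (bang I) a) n)) f)
    (h' : mor (reind s n) (pullback_cotensor (reind (bang J) a) f)) : Prop :=
  transposes s t (vcod a) (vdom n) (vdom f)
    (sq_dom h \m reind_map s (pprod_inr (reind (bang I) a) n))
    (sq_dom h') /\
  transposes s t (vdom a) (vcod n) (vdom f)
    (sq_dom h \m reind_map s (pprod_inl (reind (bang I) a) n))
    (pcot_fst (reind (bang J) a) f \m sq_cod h') /\
  transposes s t (vcod a) (vcod n) (vcod f)
    (sq_cod h)
    (pcot_snd (reind (bang J) a) f \m sq_cod h').


End Transposition.
Arguments transposes {_ _ _ _ _ _ _ _ _} s t A U X k k'.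
Arguments square_transposes {_ _ _ _ _ _ _ _ _ _ _} s t a n f h h'.

(* Main.v *)
Require Import Defs.
From Stdlib Require Import FinFun ProofIrrelevance.

(** The comparison [s^* I^* A (x)_K s^* U -> s^* (I^* A (x)_I U)] is invertible,
    because the tensor product preserves cartesian maps, and evaluation
    restricted along a cartesian map into [J^* A] is still couniversal, because
    reindexing preserves the cotensors.  As [s^* I^* A] and [J^* A] are both
    reindexed from [1], maps [s^* (I^* A (x)_I U) -> X] over [t] are in natural
    bijection with maps [s^* U -> {J^* A, X}_J] over [t], for every [s] and [t]
    out of a common [K].  Stability of pushouts and pullbacks lifts this to a
    bijection of squares, natural in [K] and matching diagonal fillers.  Hence
    the transpose of a universal family is universal, and universal families are
    unique up to isomorphism. *)

(** Definite description supplies a function in each direction, and uniqueness of partners makes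
    them mutually inverse. Transposition can therefore stay a relation until the very end. *)
Lemma bijective_of_relation {S T : Type} (R : S -> T -> Prop) :
  (forall x, exists! y, R x y) -> (forall y, exists! x, R x y) ->
  exists phi : S -> T, Bijective phi /\ forall x, R x (phi x).
Proof.
  intros HS HT.
  exists (fun x => the (HS x)). split.
  - exists (fun y => the (HT y)). split.
    + intros x. apply the_unique. apply (the_spec (HS x)).
    + intros y. apply the_unique. apply (the_spec (HT y)).
  - intros x. apply (the_spec (HS x)).
Qed.

(** * Cartesian maps in a fibration *)

Section Fibration.
Context {B : Category} {E : CatOver B}.

Lemma proj_post {I J : B} {t : hom I J} {X : E I} {Y Z : E J}
    (g : over (idm J) Y Z) (k : mor X Y) :
  proj k = t -> proj (g \m k) = t.
Proof. intros e. now rewrite proj_comp, oproj, comp_id_l. Qed.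

Lemma proj_pre {I J : B} {t : hom I J} {X Y : E I} {Z : E J}
    (g : over (idm I) X Y) (k : mor Y Z) :
  proj k = t -> proj (k \m g) = t.
Proof. intros e. now rewrite proj_comp, oproj, comp_id_r. Qed.

(** Stated for bare morphisms with equal projections, so that the base maps need only be provably
    equal. *)
Lemma cartesian_mono {I J : B} {X : E I} {Y : E J} {f : mor X Y} :
  is_cartesian f -> forall (K : B) (Z : E K) (h h' : mor Z X),
  proj h = proj h' -> f \m h = f \m h' -> h = h'.
Proof.
  intros cf K Z h h' ep em.
  destruct (cf K Z (proj h) (f \m h) (proj_comp f h)) as [k [_ hk]].
  pose proof (f_equal omor (hk (Over h eq_refl) eq_refl)) as e.
  pose proof (f_equal omor (hk (Over h' (eq_sym ep)) (eq_sym em))) as e'.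
  simpl in e, e'. congruence.
Qed.

Lemma cartesian_comp {I J K : B} {X : E I} {Y : E J} {Z : E K}
    {g : mor Y Z} {f : mor X Y} :
  is_cartesian g -> is_cartesian f -> is_cartesian (g \m f).
Proof.
  intros cg cf L W w h eh.
  assert (eh' : proj h = proj g \o (proj f \o w))
    by now rewrite eh, proj_comp, comp_assoc.
  destruct (cg L W _ h eh') as [k [hk _]].
  destruct (cf L W w k (oproj k)) as [l [hl _]].
  exists l; split.
  - now rewrite <- mcomp_assoc, hl.
  - intros l' hl'. apply over_eq, (cartesian_mono cf); [now rewrite !oproj|].
    apply (cartesian_mono cg); [now rewrite !proj_comp, !oproj|].
    now rewrite hl, hk, mcomp_assoc.
Qed.

Lemma cartesian_cancel {I J K : B} {X : E I} {Y : E J} {Z : E K}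
    {g : mor Y Z} {f : mor X Y} :
  is_cartesian g -> is_cartesian (g \m f) -> is_cartesian f.
Proof.
  intros cg cgf L W w h eh.
  assert (eh' : proj (g \m h) = proj (g \m f) \o w)
    by now rewrite !proj_comp, eh, comp_assoc.
  destruct (cgf L W w _ eh') as [k [hk _]].
  exists k; split.
  - apply (cartesian_mono cg); [now rewrite proj_comp, oproj|].
    now rewrite mcomp_assoc.
  - intros k' hk'. apply over_eq, (cartesian_mono cgf); [now rewrite !oproj|].
    now rewrite hk, <- mcomp_assoc, hk'.
Qed.

(** Each of the two cartesian maps factors through the other, and both composites cancel to
    identities because cartesian maps are monic over a fixed base map. *)
Lemma cartesian_vertical_iso {K J : B} {t : hom K J} {X Y : E K} {Z : E J}
    {f : over t X Z} {g : over t Y Z} :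
  is_cartesian f -> is_cartesian g ->
  exists (d : over (idm K) X Y) (d' : over (idm K) Y X),
    g \m d = f /\ f \m d' = g /\ d \m d' = mid Y /\ d' \m d = mid X.
Proof.
  intros cf cg.
  assert (ef : proj f = proj g \o idm K) by now rewrite !oproj, comp_id_r.
  assert (eg : proj g = proj f \o idm K) by now rewrite !oproj, comp_id_r.
  destruct (cg K X _ f ef) as [d [hd _]].
  destruct (cf K Y _ g eg) as [d' [hd' _]].
  exists d, d'. repeat split; trivial.
  - apply (cartesian_mono cg);
      [now rewrite proj_comp, !oproj, proj_id, comp_id_l|].
    now rewrite mcomp_assoc, hd, hd', mcomp_id_r.
  - apply (cartesian_mono cf);
      [now rewrite proj_comp, !oproj, proj_id, comp_id_l|].
    now rewrite mcomp_assoc, hd', hd, mcomp_id_r.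
Qed.

(** * Reindexing and canonical cartesian maps *)

Context {clE : Cleavage E}.

Lemma lift_mono {I J K : B} {u : hom I J} {Y : E J} {Z : E K}
    (h h' : mor Z (reind u Y)) :
  proj h = proj h' -> lift u Y \m h = lift u Y \m h' -> h = h'.
Proof. apply cartesian_mono, @lift_cartesian. Qed.

Lemma factor_lift {J K : B} {t : hom K J} {Y : E J} {Z : E K} (g : mor Z Y) :
  proj g = t -> exists h : over (idm K) Z (reind t Y), lift t Y \m h = g.
Proof.
  intros e.
  assert (e' : proj g = t \o idm K) by now rewrite comp_id_r.
  exists (factor e'). apply lift_factor.
Qed.

Lemma reind_map_id {I J : B} (u : hom I J) (X : E J) :
  omor (reind_map u (Over (mid X) (proj_id X))) = mid (reind u X).
Proof. exact (f_equal omor (fmap_id (reindexing u) X)). Qed.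

Lemma reind_map_comp {I J : B} (u : hom I J) {X Y Z : E J}
    (g : over (idm J) Y Z) (f : over (idm J) X Y) (h : over (idm J) X Z) :
  omor h = g \m f -> omor (reind_map u h) = reind_map u g \m reind_map u f.
Proof.
  intros e.
  assert (e' : h = @comp (fibre E J) X Y Z g f) by now apply over_eq.
  rewrite e'. exact (f_equal omor (fmap_comp (reindexing u) g f)).
Qed.

Lemma canon_natural {K K' I : B} {u : hom K I} {t : hom K' K} {v : hom K' I}
    (e : v = u \o t) {X Y : E I} (f : over (idm I) X Y) :
  reind_map u f \m canon e X = canon e Y \m reind_map v f.
Proof.
  apply lift_mono.
  - now rewrite !proj_comp, !oproj, comp_id_l, comp_id_r.
  - now rewrite !mcomp_assoc, lift_reind_map, lift_canon, <- mcomp_assoc,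
      lift_canon, lift_reind_map.
Qed.

Lemma canon_inv {K K' I : B} {u : hom K I} {v : hom K' I}
    {i : hom K' K} {i' : hom K K'} (e : v = u \o i) (e' : u = v \o i') (Y : E I) :
  i \o i' = idm K -> canon e Y \m canon e' Y = mid (reind u Y).
Proof.
  intros ei.
  assert (e'' : u = u \o (i \o i')) by now rewrite ei, comp_id_r.
  (* The type of [e''] mentions [i \o i'], so [e''] is generalised before that composite is replaced
     by the identity. *)
  rewrite <- (canon_comp e e' e''). revert e''. rewrite ei. intros e''.
  apply canon_id.
Qed.

(** * Universal properties of fibrewise pushouts and pullbacks against non-vertical maps *)

(** A map over [t] into [X] is a vertical map into the reindexing of [X] along [t], so the pushout
    property in the fibre over [K] already suffices. *)
Lemma pushout_over_ex {K J : B} {t : hom K J} {a b c p : E K}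
    {f : @hom (fibre E K) a b} {g : @hom (fibre E K) a c}
    {i : @hom (fibre E K) b p} {j : @hom (fibre E K) c p} :
  is_pushout f g i j ->
  forall (X : E J) (k : mor b X) (l : mor c X),
  proj k = t -> proj l = t -> k \m omor f = l \m omor g ->
  exists h : over t p X, h \m omor i = k /\ h \m omor j = l.
Proof.
  intros [_ up] X k l ek el e.
  destruct (factor_lift k ek) as [k1 hk]. destruct (factor_lift l el) as [l1 hl].
  assert (e1 : (k1 : @hom (fibre E K) b _) \o f = (l1 : @hom (fibre E K) c _) \o g).
  { apply over_eq, lift_mono; simpl; [now rewrite !proj_comp, !oproj|].
    now rewrite !mcomp_assoc, hk, hl. }
  destruct (up _ _ _ e1) as [h [[h1 h2] _]].
  assert (eh : proj (lift t X \m omor h) = t)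
    by now rewrite proj_comp, !oproj, comp_id_r.
  exists (Over _ eh). simpl.
  rewrite <- !mcomp_assoc, <- hk, <- hl, <- h1, <- h2. now split.
Qed.

Lemma pushout_over_epi {K J : B} {a b c p : E K}
    {f : @hom (fibre E K) a b} {g : @hom (fibre E K) a c}
    {i : @hom (fibre E K) b p} {j : @hom (fibre E K) c p} :
  is_pushout f g i j ->
  forall (X : E J) (h h' : mor p X), proj h = proj h' ->
  h \m omor i = h' \m omor i -> h \m omor j = h' \m omor j -> h = h'.
Proof.
  intros [sq up] X h h' ep ei ej.
  destruct (factor_lift h eq_refl) as [h1 e1].
  destruct (factor_lift h' (eq_sym ep)) as [h1' e1'].
  set (q := h1 : @hom (fibre E K) p (reind (proj h) X)).
  set (q' := h1' : @hom (fibre E K) p (reind (proj h) X)).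
  assert (eq1 : q' \o i = q \o i).
  { apply over_eq, lift_mono; simpl; [now rewrite !proj_comp, !oproj|].
    subst q q'; now rewrite !mcomp_assoc, e1, e1'. }
  assert (eq2 : q' \o j = q \o j).
  { apply over_eq, lift_mono; simpl; [now rewrite !proj_comp, !oproj|].
    subst q q'; now rewrite !mcomp_assoc, e1, e1'. }
  assert (e : (q \o i) \o f = (q \o j) \o g) by now rewrite <- !comp_assoc, sq.
  destruct (up _ _ _ e) as [r [_ hr]].
  assert (eqq : q = q') by now rewrite <- (hr q), <- (hr q').
  exact (eq_trans (eq_sym e1)
    (eq_trans (f_equal (fun r => lift _ X \m omor r) eqq) e1')).
Qed.

(** Here the map over [t] ends at the pullback itself. Its vertical part ends at the reindexed
    pullback, which is again a pullback by stability. *)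
Lemma pullback_over_ex {pbE : FibredPullbacks E} {K J : B} {t : hom K J}
    {a b c p : E J}
    {f : @hom (fibre E J) b a} {g : @hom (fibre E J) c a}
    {i : @hom (fibre E J) p b} {j : @hom (fibre E J) p c} :
  is_pullback f g i j ->
  forall (Z : E K) (k : mor Z b) (l : mor Z c),
  proj k = t -> proj l = t -> omor f \m k = omor g \m l ->
  exists h : over t Z p, omor i \m h = k /\ omor j \m h = l.
Proof.
  intros pbk Z k l ek el e.
  destruct (fpb_stable t pbk) as [_ up].
  destruct (factor_lift k ek) as [k1 hk]. destruct (factor_lift l el) as [l1 hl].
  assert (e1 : fmap (reindexing t) f \o (k1 : @hom (fibre E K) Z (reindexing t b))
             = fmap (reindexing t) g \o (l1 : @hom (fibre E K) Z (reindexing t c))).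
  { apply over_eq, lift_mono; simpl; [now rewrite !proj_comp, !oproj|].
    now rewrite !mcomp_assoc, !lift_reind_map, <- !mcomp_assoc, hk, hl. }
  destruct (up _ _ _ e1) as [h [[h1 h2] _]].
  assert (eh : proj (lift t p \m omor h) = t)
    by now rewrite proj_comp, !oproj, comp_id_r.
  exists (Over _ eh). simpl.
  rewrite !mcomp_assoc, <- !lift_reind_map, <- !mcomp_assoc, <- hk, <- hl, <- h1, <- h2.
  now split.
Qed.

Lemma pullback_over_mono {pbE : FibredPullbacks E} {K J : B}
    {a b c p : E J}
    {f : @hom (fibre E J) b a} {g : @hom (fibre E J) c a}
    {i : @hom (fibre E J) p b} {j : @hom (fibre E J) p c} :
  is_pullback f g i j ->
  forall (Z : E K) (h h' : mor Z p), proj h = proj h' ->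
  omor i \m h = omor i \m h' -> omor j \m h = omor j \m h' -> h = h'.
Proof.
  intros pbk Z h h' ep ei ej.
  destruct (fpb_stable (proj h) pbk) as [sq up].
  destruct (factor_lift h eq_refl) as [h1 e1].
  destruct (factor_lift h' (eq_sym ep)) as [h1' e1'].
  set (F := reindexing (E := E) (proj h)) in *.
  set (q := h1 : @hom (fibre E K) Z (F p)).
  set (q' := h1' : @hom (fibre E K) Z (F p)).
  assert (eq1 : fmap F i \o q' = fmap F i \o q).
  { apply over_eq, lift_mono; simpl; [now rewrite !proj_comp, !oproj|].
    subst q q'; now rewrite !mcomp_assoc, !lift_reind_map, <- !mcomp_assoc, e1, e1'. }
  assert (eq2 : fmap F j \o q' = fmap F j \o q).
  { apply over_eq, lift_mono; simpl; [now rewrite !proj_comp, !oproj|].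
    subst q q'; now rewrite !mcomp_assoc, !lift_reind_map, <- !mcomp_assoc, e1, e1'. }
  assert (e : fmap F f \o (fmap F i \o q) = fmap F g \o (fmap F j \o q))
    by now rewrite !comp_assoc, sq.
  destruct (up _ _ _ e) as [r [_ hr]].
  assert (eqq : q = q') by now rewrite <- (hr q), <- (hr q').
  exact (eq_trans (eq_sym e1)
    (eq_trans (f_equal (fun r => lift _ p \m omor r) eqq) e1')).
Qed.

(** * Universal families of lifting problems and their solutions *)

(** The condition that [is_universal] imposes on [t]. It defines the morphisms of a category of
    families, whose terminal objects are the universal ones. *)
Definition comparison {I J : B} {n : Vert E I} {g : Vert E J}
    (F G : LiftingFamily n g) (t : hom (lf_ob F) (lf_ob G)) : Prop :=
  exists e : lf_l F = lf_l G \o t,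
    lf_r F = lf_r G \o t /\ omor (lf_sq F) = lf_sq G \m canon e n.

Lemma comparison_id {I J : B} {n : Vert E I} {g : Vert E J} (F : LiftingFamily n g) :
  comparison F F (idm (lf_ob F)).
Proof.
  exists (eq_sym (comp_id_r _)). split; [now rewrite comp_id_r|].
  now rewrite canon_id, mcomp_id_r.
Qed.

Lemma comparison_comp {I J : B} {n : Vert E I} {g : Vert E J}
    {F G H : LiftingFamily n g} {t : hom (lf_ob F) (lf_ob G)}
    {r : hom (lf_ob G) (lf_ob H)} :
  comparison G H r -> comparison F G t -> comparison F H (r \o t).
Proof.
  intros (e & er & es) (e' & er' & es').
  assert (e'' : lf_l F = lf_l H \o (r \o t)) by now rewrite e', e, comp_assoc.
  exists e''. split; [now rewrite er', er, comp_assoc|].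
  now rewrite es', es, (canon_comp e e' e''), mcomp_assoc.
Qed.

Lemma universal_comparison_iso {I J : B} {n : Vert E I} {g : Vert E J}
    {F G : LiftingFamily n g} :
  is_universal F -> is_universal G ->
  exists t : hom (lf_ob F) (lf_ob G), is_iso t /\ comparison F G t.
Proof.
  intros uF uG.
  destruct (uG F) as [t [ht _]], (uF G) as [r [hr _]].
  change (comparison F G t) in ht. change (comparison G F r) in hr.
  exists t. split; [|exact ht]. exists r. split.
  - destruct (uF F) as [x [_ hx]].
    rewrite <- (hx _ (comparison_comp hr ht)). apply hx, comparison_id.
  - destruct (uG G) as [x [_ hx]].
    rewrite <- (hx _ (comparison_comp ht hr)). apply hx, comparison_id.
Qed.

(** The canonical map of [Vert E] arises from definite description and does not reduce to a pair.
    Its sides are identified by composing with the lift, which is levelwise by definition. *)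
Lemma sq_dom_canon {K K' I : B} {u : hom K I} {t : hom K' K} {v : hom K' I}
    (e : v = u \o t) (n : Vert E I) : sq_dom (omor (canon e n)) = canon e (vdom n).
Proof.
  apply lift_mono.
  - exact (eq_trans (sq_dom_proj (omor (canon e n)))
      (eq_trans (oproj (canon e n)) (eq_sym (oproj (canon e (vdom n)))))).
  - exact (eq_trans (f_equal sq_dom (lift_canon e n)) (eq_sym (lift_canon e (vdom n)))).
Qed.

Lemma sq_cod_canon {K K' I : B} {u : hom K I} {t : hom K' K} {v : hom K' I}
    (e : v = u \o t) (n : Vert E I) : sq_cod (omor (canon e n)) = canon e (vcod n).
Proof.
  apply lift_mono.
  - exact (eq_trans (oproj (canon e n)) (eq_sym (oproj (canon e (vcod n))))).
  - exact (eq_trans (f_equal sq_cod (lift_canon e n)) (eq_sym (lift_canon e (vcod n)))).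
Qed.

(** The two triangles of [Solution] for bare morphisms, without the proof that [j] lies over the
    base map, so that solutions can be restricted and transposed freely. *)
Definition solves {I J K : B} {s : hom K I} {n : Vert E I} {g : Vert E J}
    (h : mor (reind s n) g) (j : mor (reind s (vcod n)) (vdom g)) : Prop :=
  j \m vmap (reind s n) = sq_dom h /\ vmap g \m j = sq_cod h.

Lemma solves_canon {I J K K' : B} {s : hom K I} {r : hom K' K} {s' : hom K' I}
    (e : s' = s \o r) {n : Vert E I} {g : Vert E J} {h : mor (reind s n) g}
    {j : mor (reind s (vcod n)) (vdom g)} :
  solves h j -> solves (h \m canon e n) (j \m canon e (vcod n)).
Proof.
  intros [h0 h1]. split.
  - refine (eq_trans (eq_sym (mcomp_assoc j _ (reind_map s' (vmap n)))) _).
    rewrite <- canon_natural, mcomp_assoc.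
    refine (eq_trans (f_equal (fun z => z \m canon e (vdom n)) h0) _).
    exact (f_equal (fun z => sq_dom h \m z) (eq_sym (sq_dom_canon e n))).
  - refine (eq_trans (mcomp_assoc (vmap g) j _) _). rewrite h1.
    exact (f_equal (fun z => sq_cod h \m z) (eq_sym (sq_cod_canon e n))).
Qed.

Lemma solution_eq {I J : B} {n : Vert E I} {g : Vert E J} {F : LiftingFamily n g}
    (j k : Solution F) : omor j = omor k -> j = k.
Proof.
  destruct j as [j j0 j1], k as [k k0 k1]. simpl. intros e.
  apply over_eq in e. subst k. f_equal; apply proof_irrelevance.
Qed.

End Fibration.

(** * The fibrewise tensor product under reindexing *)

Section Transposition.
Context {B : Category} {CB : Cartesian B} {E : CatOver B} {clE : Cleavage E}
  {monE : CartMonoidal E}.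

Lemma ftmap_ext {I J : B} {u : hom I J} {X Y : E I} {X' Y' : E J}
    (f : over u X X') (g : over u Y Y') (h : mor (ftens X Y) (ftens X' Y')) :
  proj h = u ->
  lift (diag J) (tens X' Y') \m h = tmap f g \m lift (diag I) (tens X Y) ->
  h = ftmap f g.
Proof.
  intros ep e. apply lift_mono; [now rewrite oproj|]. now rewrite lift_ftmap.
Qed.

Lemma ftmap_mid {I : B} {X Y : E I} (f : over (idm I) X X) (g : over (idm I) Y Y) :
  omor f = mid X -> omor g = mid Y -> omor (ftmap f g) = mid (ftens X Y).
Proof.
  intros ef eg. symmetry. apply ftmap_ext; [apply proj_id|].
  now rewrite ef, eg, tmap_id, mcomp_id_l, mcomp_id_r.
Qed.

(** Followed by the lift of the diagonal, [ftmap f g] becomes a composite of the cartesian maps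
    [tmap f g] and a lift; the last lift can then be cancelled. *)
Lemma ftmap_cartesian {I J : B} {u : hom I J} {X Y : E I} {X' Y' : E J}
    (f : over u X X') (g : over u Y Y') :
  is_cartesian f -> is_cartesian g -> is_cartesian (ftmap f g).
Proof.
  intros cf cg.
  apply (cartesian_cancel (@lift_cartesian _ _ _ _ _ (diag J) (tens X' Y'))).
  rewrite lift_ftmap.
  apply cartesian_comp; [now apply tmap_cartesian|apply @lift_cartesian].
Qed.

Lemma lift_ftcomp {I J : B} (u : hom I J) (X Y : E J) :
  lift u (ftens X Y) \m ftcomp u X Y = ftmap (lift u X) (lift u Y).
Proof. apply lift_factor. Qed.

(** Source and target of the comparison both carry cartesian maps over [u] into [ftens X Y], and the
    comparison is the induced vertical isomorphism. *)
Lemma ftcomp_iso {I J : B} (u : hom I J) (X Y : E J) :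
  exists g : over (idm I) (reind u (ftens X Y)) (ftens (reind u X) (reind u Y)),
    ftcomp u X Y \m g = mid _ /\ g \m ftcomp u X Y = mid _.
Proof.
  destruct (cartesian_vertical_iso (f := ftmap (lift u X) (lift u Y))
              (g := lift u (ftens X Y))) as (d & d' & hd & _ & h1 & h2).
  - apply ftmap_cartesian; apply @lift_cartesian.
  - apply @lift_cartesian.
  - exists d'. replace (omor (ftcomp u X Y)) with (omor d); [now split|].
    apply lift_mono; [now rewrite !oproj|]. now rewrite lift_ftcomp.
Qed.

Lemma ftcomp_natural {I J : B} (u : hom I J) {X X' Y Y' : E J}
    (f : over (idm J) X X') (g : over (idm J) Y Y') :
  reind_map u (ftmap f g) \m ftcomp u X Y
  = ftcomp u X' Y' \m ftmap (reind_map u f) (reind_map u g).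
Proof.
  apply lift_mono; [now rewrite !proj_comp, !oproj|].
  rewrite !mcomp_assoc, lift_reind_map, lift_ftcomp, <- mcomp_assoc, lift_ftcomp.
  assert (ef : proj (f \m lift u X) = u) by now rewrite proj_comp, !oproj, comp_id_l.
  assert (eg : proj (g \m lift u Y) = u) by now rewrite proj_comp, !oproj, comp_id_l.
  rewrite <- (ftmap_comp (f'' := Over _ ef) (g'' := Over _ eg)); trivial.
  apply ftmap_comp; simpl; symmetry; apply lift_reind_map.
Qed.

Lemma ftcomp_canon {K K' I : B} {u : hom K I} {t : hom K' K} {v : hom K' I}
    (e : v = u \o t) (X Y : E I) :
  canon e (ftens X Y) \m ftcomp v X Y = ftcomp u X Y \m ftmap (canon e X) (canon e Y).
Proof.
  apply lift_mono; [now rewrite !proj_comp, !oproj, comp_id_l, comp_id_r|].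
  rewrite !mcomp_assoc, lift_canon, !lift_ftcomp.
  apply ftmap_comp; symmetry; apply lift_canon.
Qed.

(** * Objects reindexed from the terminal object *)

Lemma lift_bang_change {I J K : B} (s : hom K I) (t : hom K J) (A : E one) :
  lift (bang J) A \m bang_change s t A = lift (bang I) A \m lift s (reind (bang I) A).
Proof. apply lift_factor. Qed.

(** Followed by the lift along [bang J], this map is a composite of two lifts. It is the cartesian
    map along which evaluation is later restricted. *)
Lemma bang_change_cartesian {I J K : B} (s : hom K I) (t : hom K J) (A : E one) :
  is_cartesian (bang_change s t A).
Proof.
  apply (cartesian_cancel (@lift_cartesian _ _ _ _ _ (bang J) A)).
  rewrite lift_bang_change. apply cartesian_comp; apply @lift_cartesian.
Qed.

Lemma bang_change_natural {I J K : B} (s : hom K I) (t : hom K J) {A A' : E one}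
    (a : over (idm one) A A') :
  reind_map (bang J) a \m bang_change s t A
  = bang_change s t A' \m reind_map s (reind_map (bang I) a).
Proof.
  apply lift_mono; [now rewrite !proj_comp, !oproj, comp_id_l, comp_id_r|].
  rewrite !mcomp_assoc, lift_reind_map, lift_bang_change, <- !mcomp_assoc.
  now rewrite lift_bang_change, lift_reind_map, !mcomp_assoc, lift_reind_map.
Qed.

Lemma bang_change_canon {I J K K' : B} {s : hom K I} (t : hom K J) {r : hom K' K}
    {s' : hom K' I} {t' : hom K' J} (es : s' = s \o r) (et : t' = t \o r) (A : E one) :
  omor (bang_change s' t' A) = bang_change s t A \m canon es (reind (bang I) A).
Proof.
  apply lift_mono; [now rewrite !proj_comp, !oproj|].
  now rewrite mcomp_assoc, !lift_bang_change, <- mcomp_assoc, lift_canon.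
Qed.

(** * Evaluation and its couniversality over a base map *)

Context {closedE : InternallyClosed E}.

Lemma cot_ev_post {J : B} (A : E J) {X Y : E J} (f : @hom (fibre E J) X Y) :
  omor f \m cot_ev A X
  = cot_ev A Y \m ftmap (Over (mid A) (proj_id A)) (cot_post A f).
Proof. exact (f_equal omor (counit_nat (lhom A) f)). Qed.

Lemma counit_transpose {C D : Category} {F : Functor C D} (R : RightAdjoint F)
    {c : C} {d : D} (f : hom (F c) d) :
  counit R d \o fmap F (transpose R f) = f.
Proof.
  unfold transpose.
  now rewrite fmap_comp, comp_assoc, <- counit_nat, <- comp_assoc, triangle_l, comp_id_r.
Qed.

Lemma transpose_counit {C D : Category} {F : Functor C D} (R : RightAdjoint F)
    {c : C} {d : D} (g : hom c (R d)) :
  transpose R (counit R d \o fmap F g) = g.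
Proof.
  unfold transpose.
  now rewrite fmap_comp, <- comp_assoc, unit_nat, comp_assoc, triangle_r, comp_id_l.
Qed.

(** Dinaturality of evaluation in the exponent, immediate from [cot_pre] being defined as a
    transpose. *)
Lemma cot_ev_pre {J : B} {A A' : E J} (a : @hom (fibre E J) A A') (X : E J) :
  cot_ev A X \m ftmap (Over (mid A) (proj_id A)) (cot_pre a X)
  = cot_ev A' X \m ftmap a (Over (mid (cot A' X)) (proj_id (cot A' X))).
Proof. exact (f_equal omor (counit_transpose (lhom A) _)). Qed.

(* Evaluation restricted along [lift t A] is the counit for [reind t A]
   precomposed with the invertible comparison of [lhom_stable]. *)
Lemma cot_universal_lift {J K : B} (t : hom K J) (A X : E J) (V : E K)
    (l : mor (ftens (reind t A) V) X) :
  proj l = t -> exists! k : over t V (cot A X), cot_ev A X \m ftmap (lift t A) k = l.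
Proof.
  intros el.
  set (R := lhom (reind t A)).
  set (q := fmap (reindexing t) (counit (lhom A) X)
         \o (ftcomp t A (lhom A X) : @hom (fibre E K) _ _)).
  destruct (lhom_stable t A X) as [inv [hi1 hi2]].
  fold R q in inv, hi1, hi2.
  set (theta := transpose R q) in *.
  (* For [k] with vertical part [k1], evaluation over [t] is the adjunct of [theta \o k1] over [K],
     followed by a lift. The problem thus becomes one in the fibre over [K]. *)
  assert (key : forall (k : over t V (cot A X))
      (k1 : @hom (fibre E K) V (reind t (cot A X))), lift t (cot A X) \m omor k1 = k ->
      cot_ev A X \m ftmap (lift t A) k
      = lift t X \m omor (counit R (reind t X) \o fmap (tensl (reind t A)) (theta \o k1))).
  { intros k k1 hk.
    rewrite fmap_comp, comp_assoc. unfold theta at 1. rewrite counit_transpose.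
    unfold q. simpl.
    rewrite !mcomp_assoc, lift_reind_map, <- (mcomp_assoc _ _ (ftcomp _ _ _)).
    rewrite lift_ftcomp, <- mcomp_assoc.
    apply f_equal, ftmap_comp; simpl; [now rewrite mcomp_id_r|now symmetry]. }
  destruct (factor_lift l el) as [l1 hl1].
  (* The witness is the transpose over [K], carried back along the inverse of [theta]. *)
  set (k1 := inv \o transpose R (l1 : @hom (fibre E K) (tensl (reind t A) V) (reind t X))).
  assert (ek : proj (lift t (cot A X) \m omor k1) = t)
    by now rewrite proj_comp, !oproj, comp_id_r.
  exists (Over _ ek). split.
  - rewrite (key (Over _ ek) k1 eq_refl). unfold k1.
    now rewrite (comp_assoc theta inv), hi2, comp_id_l, counit_transpose.
  - intros k hk. apply over_eq. simpl.
    destruct (factor_lift k (oproj k)) as [k2 hk2].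
    rewrite <- hk2. f_equal.
    rewrite (key k k2 hk2), <- hl1 in hk.
    assert (e : transpose R (l1 : @hom (fibre E K) (tensl (reind t A) V) (reind t X))
              = theta \o (k2 : @hom (fibre E K) _ _)).
    { rewrite <- (transpose_counit R (theta \o _)). apply f_equal, over_eq, lift_mono;
        [now rewrite !oproj|now symmetry]. }
    transitivity (omor (inv \o (theta \o (k2 : @hom (fibre E K) _ _)))).
    + exact (f_equal (fun r => omor (inv \o r)) e).
    + rewrite comp_assoc, hi1, comp_id_l. reflexivity.
Qed.

(** A cartesian map [c] differs from [lift t A] by a vertical isomorphism of sources. Tensoring it
    with the identity of [V] transports the couniversal property. *)
Lemma cot_universal {J K : B} {t : hom K J} {A X : E J} {D V : E K} {c : over t D A} :
  is_cartesian c -> forall l : mor (ftens D V) X, proj l = t ->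
  exists! k : over t V (cot A X), cot_ev A X \m ftmap c k = l.
Proof.
  intros cc l el.
  destruct (cartesian_vertical_iso (@lift_cartesian _ _ _ _ _ t A) cc)
    as (d & d' & _ & hd' & h1 & h2).
  set (iV := Over (mid V) (proj_id V)).
  assert (key : forall k : over t V (cot A X),
    omor (ftmap c k) = ftmap (lift t A) k \m ftmap d' iV).
  { intros k. apply ftmap_comp; [now symmetry|simpl; now rewrite mcomp_id_r]. }
  assert (key' : ftmap d iV \m ftmap d' iV = mid _ /\ ftmap d' iV \m ftmap d iV = mid _).
  { split; (etransitivity;
      [symmetry; apply (ftmap_comp (f'' := Over (mid _) (proj_id _)) (g'' := iV));
        simpl; rewrite ?mcomp_id_l; now symmetry | now apply ftmap_mid]). }
  destruct key' as [k1 k2].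
  assert (el' : proj (l \m ftmap d iV) = t)
    by now rewrite proj_comp, oproj, el, comp_id_r.
  destruct (cot_universal_lift _ _ _ _ _ el') as [k [hk hu]].
  exists k; split.
  - now rewrite key, mcomp_assoc, hk, <- mcomp_assoc, k1, mcomp_id_r.
  - intros k' hk'. apply hu.
    now rewrite <- hk', key, <- !mcomp_assoc, k2, mcomp_id_r.
Qed.

(** * Transposition of single maps over a base map *)

Section Fixed.
Context {I J K : B} {s : hom K I} {t : hom K J}.

Lemma transposes_proj {A : E one} {U : E I} {X : E J}
    {k : mor (reind s (ftens (reind (bang I) A) U)) X}
    {k' : mor (reind s U) (cot (reind (bang J) A) X)} :
  transposes s t A U X k k' -> proj k = t /\ proj k' = t.
Proof.
  intros [e h]. split; [|exact e].
  apply (f_equal proj) in h.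
  now rewrite !proj_comp, !oproj, comp_id_l, comp_id_r in h.
Qed.

(** From left to right, existence and uniqueness of transposes come from couniversality of
    evaluation along [bang_change]; from right to left they come from invertibility of [ftcomp]. *)
Lemma transposes_ex_r {A : E one} {U : E I} {X : E J}
    (k : mor (reind s (ftens (reind (bang I) A) U)) X) :
  proj k = t -> exists k', transposes s t A U X k k'.
Proof.
  intros ek.
  destruct (cot_universal (bang_change_cartesian s t A) (X := X) (V := reind s U)
              (k \m ftcomp s (reind (bang I) A) U)) as [k' [hk' _]].
  { now rewrite proj_comp, oproj, comp_id_r. }
  exists (omor k'), (oproj k'). rewrite <- hk'. repeat f_equal. now apply over_eq.
Qed.

Lemma transposes_ex_l {A : E one} {U : E I} {X : E J}
    (k' : mor (reind s U) (cot (reind (bang J) A) X)) :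
  proj k' = t -> exists k, transposes s t A U X k k'.
Proof.
  intros ek.
  destruct (ftcomp_iso s (reind (bang I) A) U) as [g [_ h2]].
  exists (cot_ev (reind (bang J) A) X \m ftmap (bang_change s t A) (Over k' ek) \m g), ek.
  now rewrite <- mcomp_assoc, h2, mcomp_id_r.
Qed.

Lemma transposes_uniq_r {A : E one} {U : E I} {X : E J}
    {k : mor (reind s (ftens (reind (bang I) A) U)) X}
    {k' k'' : mor (reind s U) (cot (reind (bang J) A) X)} :
  transposes s t A U X k k' -> transposes s t A U X k k'' -> k' = k''.
Proof.
  intros T [e'' h'']. destruct (transposes_proj T) as [ek _]. destruct T as [e' h'].
  destruct (cot_universal (bang_change_cartesian s t A) (X := X) (V := reind s U)
              (k \m ftcomp s (reind (bang I) A) U)) as [x [_ hx]].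
  { now rewrite proj_comp, oproj, comp_id_r. }
  pose proof (f_equal omor (hx _ (eq_sym h'))) as q'.
  pose proof (f_equal omor (hx _ (eq_sym h''))) as q''.
  simpl in q', q''. congruence.
Qed.

Lemma transposes_uniq_l {A : E one} {U : E I} {X : E J}
    {k l : mor (reind s (ftens (reind (bang I) A) U)) X}
    {k' : mor (reind s U) (cot (reind (bang J) A) X)} :
  transposes s t A U X k k' -> transposes s t A U X l k' -> k = l.
Proof.
  intros [e h] [e' h'].
  destruct (ftcomp_iso s (reind (bang I) A) U) as [g [h1 _]].
  rewrite <- (mcomp_id_r k), <- (mcomp_id_r l), <- h1, !mcomp_assoc, h, h'.
  now rewrite (proof_irrelevance _ e e').
Qed.

(** With [transposes_post] and [transposes_change], this gives naturality of transposition in its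
    three variables, the means of carrying commutation conditions across. *)
Lemma transposes_pre {A : E one} {U U' : E I} {X : E J} (n : @hom (fibre E I) U' U)
    {k : mor (reind s (ftens (reind (bang I) A) U)) X}
    {k' : mor (reind s U) (cot (reind (bang J) A) X)} :
  transposes s t A U X k k' ->
  transposes s t A U' X
    (k \m reind_map s (fmap (tensl (reind (bang I) A)) n)) (k' \m reind_map s n).
Proof.
  intros [e h].
  assert (e' : proj (k' \m reind_map s n) = t)
    by now rewrite proj_comp, oproj, e, comp_id_r.
  exists e'. simpl. rewrite <- mcomp_assoc, ftcomp_natural, mcomp_assoc, h, <- mcomp_assoc.
  f_equal. symmetry. apply ftmap_comp; simpl; [|reflexivity].
  now rewrite reind_map_id, mcomp_id_r.
Qed.

Lemma transposes_post {A : E one} {U : E I} {X Y : E J} (f : @hom (fibre E J) X Y)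
    {k : mor (reind s (ftens (reind (bang I) A) U)) X}
    {k' : mor (reind s U) (cot (reind (bang J) A) X)} :
  transposes s t A U X k k' ->
  transposes s t A U Y (omor f \m k) (omor (cot_post (reind (bang J) A) f) \m k').
Proof.
  intros [e h].
  assert (e' : proj (omor (cot_post (reind (bang J) A) f) \m k') = t)
    by now rewrite proj_comp, oproj, e, comp_id_l.
  exists e'. rewrite <- mcomp_assoc, h, mcomp_assoc, cot_ev_post, <- mcomp_assoc.
  f_equal. symmetry. apply ftmap_comp; simpl; [|reflexivity].
  now rewrite mcomp_id_l.
Qed.

(** Three facts combine: [ftcomp] is natural, [bang_change] intertwines the reindexings of [a] over
    [I] and over [J], and evaluation is dinatural in the exponent. *)
Lemma transposes_change {A A' : E one} (a : over (idm one) A A') {U : E I} {X : E J}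
    {k : mor (reind s (ftens (reind (bang I) A') U)) X}
    {k' : mor (reind s U) (cot (reind (bang J) A') X)} :
  transposes s t A' U X k k' ->
  transposes s t A U X
    (k \m reind_map s (fmap (tensr U) (reind_map (bang I) a : @hom (fibre E I) _ _)))
    (omor (cot_pre (reind_map (bang J) a : @hom (fibre E J) _ _) X) \m k').
Proof.
  intros [e h]. set (aJ := reind_map (bang J) a).
  assert (e' : proj (omor (cot_pre (aJ : @hom (fibre E J) _ _) X) \m k') = t)
    by now rewrite proj_comp, oproj, e, comp_id_l.
  exists e'. simpl. rewrite <- mcomp_assoc, ftcomp_natural, mcomp_assoc, h, <- mcomp_assoc.
  assert (eb : proj (aJ \m bang_change s t A) = t)
    by now rewrite proj_comp, !oproj, comp_id_l.
  transitivity (cot_ev (reind (bang J) A') X \m ftmap (Over _ eb) (Over k' e)).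
  { f_equal. symmetry. apply ftmap_comp; simpl.
    - apply bang_change_natural.
    - now rewrite reind_map_id, mcomp_id_r. }
  rewrite (ftmap_comp (f' := aJ)
    (g' := Over (mid (cot (reind (bang J) A') X)) (proj_id _))
    (f := bang_change s t A) (g := Over k' e));
    [|reflexivity|simpl; now rewrite mcomp_id_l].
  rewrite mcomp_assoc, <- (cot_ev_pre (aJ : @hom (fibre E J) _ _)), <- mcomp_assoc.
  f_equal. symmetry. apply ftmap_comp; simpl; [now rewrite mcomp_id_l|reflexivity].
Qed.

(** Naturality in the parameter object [K], needed because universality compares families over
    different objects. It holds since [ftcomp] and [bang_change] both respect canonical maps. *)
Lemma transposes_canon {K' : B} {r : hom K' K} {s' : hom K' I} {t' : hom K' J}
    (es : s' = s \o r) (et : t' = t \o r) {A : E one} {U : E I} {X : E J}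
    {k : mor (reind s (ftens (reind (bang I) A) U)) X}
    {k' : mor (reind s U) (cot (reind (bang J) A) X)} :
  transposes s t A U X k k' ->
  transposes s' t' A U X (k \m canon es _) (k' \m canon es U).
Proof.
  intros [e h].
  assert (e' : proj (k' \m canon es U) = t') by now rewrite proj_comp, oproj, e.
  exists e'. rewrite <- mcomp_assoc, ftcomp_canon, mcomp_assoc, h, <- mcomp_assoc.
  f_equal. symmetry. apply ftmap_comp; [apply bang_change_canon; exact et|reflexivity].
Qed.

End Fixed.

(** * Universal properties of the pushout product and the pullback cotensor *)

Context {poE : FibredPushouts E} {pbE : FibredPullbacks E}.

Lemma pprod_map_inl {I : B} (a b : Vert E I) :
  vmap (pushout_product a b) \m pprod_inl a b = omor (fmap (tensr (vcod b)) (vmap a)).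
Proof.
  exact (f_equal omor (proj1 (the_spec (proj2 (po_is_pushout (fpo I) _ _) _ _ _
    (tens_interchange (vmap a) (vmap b)))))).
Qed.

Lemma pprod_map_inr {I : B} (a b : Vert E I) :
  vmap (pushout_product a b) \m pprod_inr a b = omor (fmap (tensl (vcod a)) (vmap b)).
Proof.
  exact (f_equal omor (proj2 (the_spec (proj2 (po_is_pushout (fpo I) _ _) _ _ _
    (tens_interchange (vmap a) (vmap b)))))).
Qed.

Lemma pcot_fst_map {J : B} (a f : Vert E J) :
  pcot_fst a f \m vmap (pullback_cotensor a f) = omor (cot_pre (vmap a) (vdom f)).
Proof.
  exact (f_equal omor (proj1 (the_spec (proj2 (pb_is_pullback (fpb J) _ _) _ _ _
    (cot_interchange (vmap a) (vmap f)))))).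
Qed.

Lemma pcot_snd_map {J : B} (a f : Vert E J) :
  pcot_snd a f \m vmap (pullback_cotensor a f) = omor (cot_post (vcod a) (vmap f)).
Proof.
  exact (f_equal omor (proj2 (the_spec (proj2 (pb_is_pullback (fpb J) _ _) _ _ _
    (cot_interchange (vmap a) (vmap f)))))).
Qed.

(** Lifting problems start at the reindexed pushout product, so stability is what allows maps out of
    it to be given by two legs. *)
Lemma pprod_is_pushout {I K : B} (s : hom K I) (a b : Vert E I) :
  is_pushout
    (fmap (reindexing s) (fmap (tensl (vdom a)) (vmap b)))
    (fmap (reindexing s) (fmap (tensr (vdom b)) (vmap a)))
    (fmap (reindexing s) (pprod_inl a b : @hom (fibre E I) _ _))
    (fmap (reindexing s) (pprod_inr a b : @hom (fibre E I) _ _)).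
Proof. apply fpo_stable, po_is_pushout. Qed.

Lemma pcot_is_pullback {J : B} (a f : Vert E J) :
  is_pullback (cot_post (vdom a) (vmap f)) (cot_pre (vmap a) (vcod f))
    (pcot_fst a f : @hom (fibre E J) _ _) (pcot_snd a f : @hom (fibre E J) _ _).
Proof. apply pb_is_pullback. Qed.

(** * Transposition of squares and of diagonal fillers *)

Section Squares.
Context {I J K : B} {s : hom K I} {t : hom K J}.
Context {a : Vert E one} {n : Vert E I} {f : Vert E J}.

Local Notation aI := (reind (bang I) a : Vert E I).
Local Notation aJ := (reind (bang J) a : Vert E J).
Local Notation tr A U X k k' := (transposes s t A U X k k').

Lemma reind_pprod_map_inl :
  reind_map s (vmap (pushout_product aI n)) \m reind_map s (pprod_inl aI n)
  = reind_map s (fmap (tensr (vcod n)) (reind_map (bang I) (vmap a) : @hom (fibre E I) _ _)).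
Proof. symmetry. apply reind_map_comp. symmetry. apply pprod_map_inl. Qed.

Lemma reind_pprod_map_inr :
  reind_map s (vmap (pushout_product aI n)) \m reind_map s (pprod_inr aI n)
  = reind_map s (fmap (tensl (reind (bang I) (vcod a))) (vmap n)).
Proof. symmetry. apply reind_map_comp. symmetry. apply pprod_map_inr. Qed.

Lemma pcot_reind_fst_map :
  pcot_fst aJ f \m vmap (pullback_cotensor aJ f)
  = omor (cot_pre (reind_map (bang J) (vmap a) : @hom (fibre E J) _ _) (vdom f)).
Proof. apply pcot_fst_map. Qed.

Lemma pcot_reind_snd_map :
  pcot_snd aJ f \m vmap (pullback_cotensor aJ f)
  = omor (cot_post (reind (bang J) (vcod a)) (vmap f)).
Proof. apply pcot_snd_map. Qed.

Lemma square_transposes_proj {h : mor (reind s (pushout_product aI n)) f}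
    {h' : mor (reind s n) (pullback_cotensor aJ f)} :
  square_transposes s t a n f h h' -> proj h = t /\ proj h' = t.
Proof.
  intros (_ & _ & T). destruct (transposes_proj T) as [e e'].
  split; [exact e|]. now rewrite proj_comp, oproj, comp_id_l in e'.
Qed.

(** The device by which each commutation condition below is exchanged for its transpose. *)
Lemma transposes_eq {A : E one} {U : E I} {X : E J}
    {k l : mor (reind s (ftens (reind (bang I) A) U)) X}
    {k' l' : mor (reind s U) (cot (reind (bang J) A) X)} :
  tr A U X k k' -> tr A U X l l' -> k = l <-> k' = l'.
Proof.
  intros Tk Tl. split; intros e; subst.
  - exact (transposes_uniq_r Tk Tl).
  - exact (transposes_uniq_l Tk Tl).
Qed.

(** Either square amounts to three maps and three equations, which correspond crosswise. Gluing on A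
    (x) U becomes commutativity towards {A, X}; commutativity on A (x) V becomes gluing in {A, Y};
    commutativity on B (x) U becomes commutativity towards {B, Y}. *)
Lemma square_transposes_ex_r (h : mor (reind s (pushout_product aI n)) f) :
  proj h = t -> exists h', square_transposes s t a n f h h'.
Proof.
  intros ec. pose proof (eq_trans (sq_dom_proj h) ec) as ed.
  destruct (transposes_ex_r (s := s) (t := t) (U := vdom n) (X := vdom f) (A := vcod a)
    (sq_dom h \m reind_map s (pprod_inr aI n))) as [uU TU].
  { now rewrite proj_comp, oproj, comp_id_r. }
  destruct (transposes_ex_r (s := s) (t := t) (U := vcod n) (X := vdom f) (A := vdom a)
    (sq_dom h \m reind_map s (pprod_inl aI n))) as [uA TA].
  { now rewrite proj_comp, oproj, comp_id_r. }
  destruct (transposes_ex_r (s := s) (t := t) (U := vcod n) (X := vcod f) (A := vcod a)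
    (sq_cod h) ec) as [uB TB].
  destruct (transposes_proj TU) as [_ eU], (transposes_proj TA) as [_ eA],
    (transposes_proj TB) as [_ eB].
  pose proof (pullback_over_ex (t := t) (pcot_is_pullback aJ f)) as P.
  destruct (P (reind s (vcod n)) uA uB eA eB) as [v [hA hB]].
  (* Agreement in {A, Y} is the transpose of the commutativity of [h] on A (x) V. *)
  { apply (transposes_eq (transposes_post (vmap f) TA) (transposes_change (vmap a) TB)).
    rewrite <- reind_pprod_map_inl, !mcomp_assoc. f_equal. exact (sq_comm h). }
  change (pcot_fst aJ f \m v = uA) in hA. change (pcot_snd aJ f \m v = uB) in hB.
  assert (sq : vmap (pullback_cotensor aJ f) \m uU = v \m vmap (reind s n)).
  { apply (pullback_over_mono (pcot_is_pullback aJ f)).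
    - transitivity t; [apply proj_post; exact eU|symmetry; apply proj_pre, oproj].
    (* The {A, X} leg transposes to the reindexed pushout square itself. *)
    - rewrite !mcomp_assoc, pcot_fst_map, hA.
      apply (transposes_eq (transposes_change (vmap a) TU) (transposes_pre (vmap n) TA)).
      rewrite <- !mcomp_assoc. f_equal. symmetry.
      exact (f_equal omor (proj1 (pprod_is_pushout s aI n))).
    - rewrite !mcomp_assoc, pcot_snd_map, hB.
      apply (transposes_eq (transposes_post (vmap f) TU) (transposes_pre (vmap n) TB)).
      rewrite <- reind_pprod_map_inr, !mcomp_assoc. f_equal. exact (sq_comm h). }
  pose (mk := @Build_Square B E K J (reind s n) (pullback_cotensor aJ f)).
  exists (mk uU v sq).
  rewrite <- hA in TA. rewrite <- hB in TB. exact (conj TU (conj TA TB)).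
Qed.

Lemma square_transposes_ex_l (h' : mor (reind s n) (pullback_cotensor aJ f)) :
  proj h' = t -> exists h, square_transposes s t a n f h h'.
Proof.
  intros ec. pose proof (eq_trans (sq_dom_proj h') ec) as ed. simpl in ec.
  destruct (transposes_ex_l (s := s) (t := t) (U := vdom n) (X := vdom f) (A := vcod a)
    (sq_dom h') ed) as [kU TU].
  destruct (transposes_ex_l (s := s) (t := t) (U := vcod n) (X := vdom f) (A := vdom a)
    (pcot_fst aJ f \m sq_cod h')) as [kA TA].
  { now rewrite proj_comp, oproj, comp_id_l. }
  destruct (transposes_ex_l (s := s) (t := t) (U := vcod n) (X := vcod f) (A := vcod a)
    (pcot_snd aJ f \m sq_cod h')) as [kB TB].
  { now rewrite proj_comp, oproj, comp_id_l. }
  destruct (transposes_proj TU) as [eU _], (transposes_proj TA) as [eA _],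
    (transposes_proj TB) as [eB _].
  pose proof (pushout_over_ex (t := t) (pprod_is_pushout s aI n)) as P.
  destruct (P (vdom f) kA kU eA eU) as [d [hA hU]].
  (* Agreement on A (x) U is the transpose of the {A, X} leg of the commutativity of [h']. *)
  { apply (transposes_eq (transposes_pre (vmap n) TA) (transposes_change (vmap a) TU)).
    rewrite <- pcot_reind_fst_map, <- !mcomp_assoc. f_equal. symmetry. exact (sq_comm h'). }
  change (d \m reind_map s (pprod_inl aI n) = kA) in hA.
  change (d \m reind_map s (pprod_inr aI n) = kU) in hU.
  assert (sq : vmap f \m d = kB \m vmap (reind s (pushout_product aI n))).
  { apply (pushout_over_epi (pprod_is_pushout s aI n)).
    - transitivity t; [apply proj_post, oproj|symmetry; apply proj_pre; exact eB].
    (* On A (x) V the equation transposes to the pullback square itself. *)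
    - transitivity (vmap f \m kA); [rewrite <- hA; symmetry; apply mcomp_assoc|].
      transitivity (kB \m (reind_map s (vmap (pushout_product aI n))
        \m reind_map s (pprod_inl aI n))); [|apply mcomp_assoc].
      rewrite reind_pprod_map_inl.
      apply (transposes_eq (transposes_post (vmap f) TA) (transposes_change (vmap a) TB)).
      rewrite !mcomp_assoc. f_equal.
      exact (f_equal omor (proj1 (pcot_is_pullback aJ f))).
    - transitivity (vmap f \m kU); [rewrite <- hU; symmetry; apply mcomp_assoc|].
      transitivity (kB \m (reind_map s (vmap (pushout_product aI n))
        \m reind_map s (pprod_inr aI n))); [|apply mcomp_assoc].
      rewrite reind_pprod_map_inr.
      apply (transposes_eq (transposes_post (vmap f) TU) (transposes_pre (vmap n) TB)).
      rewrite <- pcot_reind_snd_map, <- !mcomp_assoc. f_equal. exact (sq_comm h'). }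
  pose (mk := @Build_Square B E K J (reind s (pushout_product aI n)) f).
  exists (mk d kB sq).
  rewrite <- hA in TA. rewrite <- hU in TU. exact (conj TU (conj TA TB)).
Qed.

Lemma square_transposes_uniq_r {h : mor (reind s (pushout_product aI n)) f}
    {h' h'' : mor (reind s n) (pullback_cotensor aJ f)} :
  square_transposes s t a n f h h' -> square_transposes s t a n f h h'' -> h' = h''.
Proof.
  intros T T'.
  destruct (square_transposes_proj T) as [_ e], (square_transposes_proj T') as [_ e'].
  destruct T as (TU & TA & TB), T' as (TU' & TA' & TB').
  apply square_eq.
  - exact (transposes_uniq_r TU TU').
  - apply (pullback_over_mono (pcot_is_pullback aJ f)).
    + exact (eq_trans e (eq_sym e')).
    + exact (transposes_uniq_r TA TA').
    + exact (transposes_uniq_r TB TB').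
Qed.

Lemma square_transposes_uniq_l {h l : mor (reind s (pushout_product aI n)) f}
    {h' : mor (reind s n) (pullback_cotensor aJ f)} :
  square_transposes s t a n f h h' -> square_transposes s t a n f l h' -> h = l.
Proof.
  intros T T'.
  destruct (square_transposes_proj T) as [e _], (square_transposes_proj T') as [e' _].
  destruct T as (TU & TA & TB), T' as (TU' & TA' & TB').
  apply square_eq.
  - apply (pushout_over_epi (pprod_is_pushout s aI n)).
    + exact (eq_trans (sq_dom_proj h)
        (eq_trans (eq_trans e (eq_sym e')) (eq_sym (sq_dom_proj l)))).
    + exact (transposes_uniq_l TA TA').
    + exact (transposes_uniq_l TU TU').
  - exact (transposes_uniq_l TB TB').
Qed.

(** The upper triangle of [j] splits over the pushout and the lower triangle of [j'] over the
    pullback. The B (x) U part of the former matches the upper triangle of [j'], its A (x) V part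
    matches the {A, X} part of the latter, and the lower triangle of [j] matches the {B, Y} part. *)
Lemma solution_transposes {h : mor (reind s (pushout_product aI n)) f}
    {h' : mor (reind s n) (pullback_cotensor aJ f)}
    {j : mor (reind s (ftens (vcod aI) (vcod n))) (vdom f)}
    {j' : mor (reind s (vcod n)) (cot (vcod aJ) (vdom f))} :
  square_transposes s t a n f h h' ->
  tr (vcod a) (vcod n) (vdom f) j j' ->
  solves h j <-> solves h' j'.
Proof.
  intros S T.
  destruct (square_transposes_proj S) as [e e'], (transposes_proj T) as [ej ej'].
  destruct S as (TU & TA & TB).
  pose proof (transposes_eq (transposes_pre (vmap n) T) TU) as HU.
  pose proof (transposes_eq (transposes_change (vmap a) T) TA) as HA.
  pose proof (transposes_eq (transposes_post (vmap f) T) TB) as HB.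
  rewrite <- reind_pprod_map_inr, mcomp_assoc in HU.
  rewrite <- reind_pprod_map_inl, mcomp_assoc, <- pcot_reind_fst_map in HA.
  rewrite <- pcot_reind_snd_map in HB.
  pose proof (mcomp_assoc (pcot_fst aJ f) (vmap (pullback_cotensor aJ f)) j') as aA.
  pose proof (mcomp_assoc (pcot_snd aJ f) (vmap (pullback_cotensor aJ f)) j') as aB.
  split; intros [h1 h2]; split.
  - apply HU. now rewrite <- h1.
  - apply (pullback_over_mono (pcot_is_pullback aJ f)).
    + transitivity t; [apply proj_post; exact ej'|symmetry; exact e'].
    + refine (eq_trans aA (proj1 HA _)). now rewrite <- h1.
    + exact (eq_trans aB (proj1 HB h2)).
  - apply (pushout_over_epi (pprod_is_pushout s aI n)).
    + transitivity t; [apply proj_pre; exact ej|].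
      exact (eq_sym (eq_trans (sq_dom_proj h) e)).
    + apply HA. refine (eq_trans (eq_sym aA) _). now rewrite <- h2.
    + now apply HU.
  - apply HB. refine (eq_trans (eq_sym aB) _). now rewrite <- h2.
Qed.

Lemma square_transposes_canon {K' : B} {r : hom K' K} {s' : hom K' I} {t' : hom K' J}
    (es : s' = s \o r) (et : t' = t \o r)
    {h : mor (reind s (pushout_product aI n)) f}
    {h' : mor (reind s n) (pullback_cotensor aJ f)} :
  square_transposes s t a n f h h' ->
  square_transposes s' t' a n f (h \m canon es (pushout_product aI n)) (h' \m canon es n).
Proof.
  (* [dom] and [cod] identify the restricted legs of [h] and [h'] with the legs of the restricted
     squares. *)
  assert (dom : forall (X : E I) (x : over (idm I) X (pprod_dom aI n)),
    sq_dom h \m reind_map s x \m canon es X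
    = sq_dom h \m sq_dom (omor (canon es (pushout_product aI n))) \m reind_map s' x).
  { intros X x.
    refine (eq_trans (eq_sym (mcomp_assoc (sq_dom h) (reind_map s x) (canon es X))) _).
    refine (eq_trans (f_equal (fun z => sq_dom h \m z) (canon_natural es x)) _).
    refine (eq_trans (mcomp_assoc (sq_dom h) (canon es _) (reind_map s' x)) _).
    exact (f_equal (fun z => sq_dom h \m z \m reind_map s' x)
             (eq_sym (sq_dom_canon es (pushout_product aI n)))). }
  assert (cod : forall (Y : E J) (y : over (idm J) (vcod (pullback_cotensor aJ f)) Y),
    y \m sq_cod h' \m canon es (vcod n) = y \m (sq_cod h' \m sq_cod (omor (canon es n)))).
  { intros Y y. rewrite mcomp_assoc.
    exact (f_equal (fun z => y \m sq_cod h' \m z) (eq_sym (sq_cod_canon es n))). }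
  assert (congr : forall {A U X k l k' l'}, k = l -> k' = l' ->
    transposes s' t' A U X k k' -> transposes s' t' A U X l l') by now intros; subst.
  intros (TU & TA & TB). split; [|split].
  - exact (congr _ _ _ _ _ _ _ (dom _ _)
      (f_equal (fun z => sq_dom h' \m z) (eq_sym (sq_dom_canon es n))) (transposes_canon es et TU)).
  - exact (congr _ _ _ _ _ _ _ (dom _ _) (cod _ _) (transposes_canon es et TA)).
  - exact (congr _ _ _ _ _ _ _
      (f_equal (fun z => sq_cod h \m z) (eq_sym (sq_cod_canon es (pushout_product aI n))))
      (cod _ _) (transposes_canon es et TB)).
Qed.

End Squares.

(** * Universality of the transposed family *)

(** Any competing family transposes back to one with the same base maps. Since transposition
    commutes with restriction and is one-to-one, a base map compares the transposed families exactly
    when it compares the original ones. *)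
Lemma transpose_universal {I J : B} {a : Vert E one} {n : Vert E I} {f : Vert E J}
    (F : LiftingFamily (pushout_product (reind (bang I) a) n) f)
    (h' : over (lf_r F) (reind (lf_l F) n) (pullback_cotensor (reind (bang J) a) f)) :
  square_transposes (lf_l F) (lf_r F) a n f (lf_sq F) h' ->
  is_universal F -> is_universal (Build_LiftingFamily h').
Proof.
  intros S uF G.
  destruct (square_transposes_ex_l (s := lf_l G) (lf_sq G) (oproj (lf_sq G)))
    as [h T].
  destruct (square_transposes_proj T) as [eh _].
  destruct (uF (Build_LiftingFamily (Over h eh))) as [t [(e & er & es) ht]].
  simpl in t, e, er, es.
  exists t. split.
  - exists e. split; [exact er|].
    apply (square_transposes_uniq_r T). rewrite es.
    exact (square_transposes_canon e er S).
  - intros r (e' & er' & es'). apply ht.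
    exists e'. split; [exact er'|].
    apply (square_transposes_uniq_l T). rewrite es'.
    exact (square_transposes_canon e' er' S).
Qed.

End Transposition.

(** * Comparison of the two universal problems and their solutions *)

Theorem proposition6p2p6
  (B : Category) (CB : Cartesian B) (limB : has_finite_limits B)
  (E : CatOver B) (clE : Cleavage E) (monE : CartMonoidal E)
  (closedE : InternallyClosed E) (smallE : locally_small E)
  (poE : FibredPushouts E) (pbE : FibredPullbacks E)
  (m0 : Vert E one) (I J : B) (m : Vert E I) (f : Vert E J)
  (F : LiftingFamily (pushout_product (reind (bang I) m0) m) f)
  (G : LiftingFamily m (pullback_cotensor (reind (bang J) m0) f))
  (univF : is_universal F) (univG : is_universal G) :
  exists (i : hom (lf_ob F) (lf_ob G)) (e : lf_l F = lf_l G \o i),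
    is_iso i /\
    lf_r F = lf_r G \o i /\
    square_transposes (lf_l F) (lf_r F) m0 m f
      (lf_sq F) (lf_sq G \m canon e m) /\
    exists phi : Solution F -> Solution G,
      Bijective phi /\
      forall j : Solution F,
        transposes (lf_l F) (lf_r F) (vcod m0) (vcod m) (vdom f)
          j (phi j \m canon e (vcod m)).

Proof.
  destruct (square_transposes_ex_r (lf_sq F) (oproj (lf_sq F))) as [h S].
  destruct (square_transposes_proj S) as [_ eh].
  pose proof (transpose_universal F (Over h eh) S univF) as univF'.
  (* The transposed family keeps the base object and base maps of [F], so its comparison with [G] is
     already the required [i]. *)
  assert (C : exists (i : hom (lf_ob F) (lf_ob G)) (e : lf_l F = lf_l G \o i),
    is_iso i /\ lf_r F = lf_r G \o i /\ h = lf_sq G \m canon e m).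
  { destruct (universal_comparison_iso univF' univG) as [i [iso_i (e & er & es)]].
    exact (ex_intro _ i (ex_intro _ e (conj iso_i (conj er es)))). }
  destruct C as (i & e & iso_i & er & es).
  exists i, e. split; [exact iso_i|]. split; [exact er|].
  rewrite es in S. split; [exact S|].
  destruct iso_i as [i' [i'i ii']].
  assert (e' : lf_l G = lf_l F \o i') by now rewrite e, <- comp_assoc, ii', comp_id_r.
  pose proof (canon_inv e' e (vcod m) i'i) as c'c.
  pose proof (canon_inv e e' (vcod m) ii') as cc'.
  (* A solution [l] lives over [lf_ob G]; it is restricted along [i] before being compared with the
     transpose of [j]. *)
  apply (bijective_of_relation (fun (j : Solution F) (l : Solution G) =>
    transposes (lf_l F) (lf_r F) (vcod m0) (vcod m) (vdom f)
      j (l \m canon e (vcod m)))).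
  - intros j.
    destruct (transposes_ex_r (s := lf_l F) (A := vcod m0) (U := vcod m) (X := vdom f)
      (omor j) (oproj j)) as [j' T].
    destruct (transposes_proj T) as [_ ej'].
    (* The transpose [j'] solves the restriction of [lf_sq G] along [i]; restricting further along
       the inverse [i'] gives a solution of [lf_sq G] itself. *)
    assert (H : solves (lf_sq G) (j' \m canon e' (vcod m))).
    { pose proof (solves_canon e' (proj1 (solution_transposes S T)
        (conj (sol_upper j) (sol_lower j)))) as H.
      rewrite <- (mcomp_assoc (omor (lf_sq G))), (canon_inv e e' m ii'), mcomp_id_r in H.
      exact H. }
    assert (ep : proj (j' \m canon e' (vcod m)) = lf_r G)
      by now rewrite proj_comp, oproj, ej', er, <- comp_assoc, ii', comp_id_r.
    exists (@Build_Solution B E clE I J m _ G (Over _ ep) (proj1 H) (proj2 H)). split.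
    + assert (ee : j' \m canon e' (vcod m) \m canon e (vcod m) = j')
        by now rewrite <- mcomp_assoc, c'c, mcomp_id_r.
      rewrite <- ee in T. exact T.
    + intros l Tl. apply solution_eq.
      (* Restriction along [i] loses nothing, as restriction along [i'] undoes it. *)
      transitivity (l \m canon e (vcod m) \m canon e' (vcod m)).
      * exact (f_equal (fun z => z \m canon e' (vcod m)) (transposes_uniq_r T Tl)).
      * now rewrite <- mcomp_assoc, cc', mcomp_id_r.
  - intros l.
    assert (el : proj (l \m canon e (vcod m)) = lf_r F)
      by now rewrite proj_comp, !oproj.
    destruct (transposes_ex_l (s := lf_l F) (A := vcod m0) (U := vcod m) (X := vdom f)
      (l \m canon e (vcod m)) el) as [j T].
    destruct (transposes_proj T) as [ej _].
    destruct (proj2 (solution_transposes S T)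
      (solves_canon e (conj (sol_upper l) (sol_lower l)))) as [H0 H1].
    exists (@Build_Solution B E clE I J (pushout_product (reind (bang I) m0) m) f F
      (Over j ej) H0 H1). split.
    + exact T.
    + intros k Tk. apply solution_eq. exact (transposes_uniq_l T Tk).
Qed.
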